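(* Consider the weighted Birkhoff error term $$\mathbf{Error}_N=\left|\frac1{A_N}\sum_{n=0}^{N-1}w(n/N)f\left(\mathscr{T}_\rho^n(\theta)\right)-\int_{\mathbb{T}^d}f(x)\,dx\right|.$$ The following estimates hold as $N\to+\infty$, uniformly with respect to $\theta\in\mathbb{T}^d$. (I) If $f$ is analytic, then for almost all rotations $\rho$ and all $\zeta>1$, we have $$\mathbf{Error}_N=\mathcal{O}\left(\exp\left(-c_{\mathrm{I}}N^{\frac1{d+2}}(\ln N)^{-\frac{\zeta}{d+2}}\right)\right),$$ where $c_{\mathrm{I}}>0$ is some universal constant. (II) If $f$ is analytic, then for rotations $\rho$ with Diophantine exponent $d$, namely $$|k\cdot\rho-n|>\frac{C}{|k|^d},\qquad C>0,\quad\forall\,0\neq k\in\mathbb{Z}^d,\ \forall n\in\mathbb{Z},$$ we have $$\mathbf{Error}_N=\mathcal{O}\left(\exp\left(-c_{\mathrm{II}}N^{\frac1{d+2}}\right)\right),$$ where $c_{\mathrm{II}}>0$ is some universal constant. (III) If $f$ is a finite trigonometric polynomial, then for almost all rotations $\rho$, we have $$\mathbf{Error}_N=\mathcal{O}\left(\exp\left(-c_{\mathrm{III}}\sqrt N\right)\right),$$ where $c_{\mathrm{III}}>0$ is some universal constant.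
   Context: Let $d\in\mathbb{N}^+$ and $\mathbb{T}^d=\mathbb{R}^d/\mathbb{Z}^d$. For a rotation vector $\rho\in\mathbb{T}^d$, $\mathscr{T}_\rho(\theta)=\theta+\rho\bmod1$ on $\mathbb{T}^d$, $\theta\in\mathbb{T}^d$ is the initial point, and $f$ is an observable on $\mathbb{T}^d$. ''Almost all'' is in the sense of full Lebesgue measure. $|\cdot|$ on $\mathbb{Z}^d$ denotes a fixed norm. Let $w:\mathbb{R}\to\mathbb{R}$ be the weighting function $w(x)=\left(\int_0^1\exp(-s^{-1}(1-s)^{-1})\,ds\right)^{-1}\exp(-x^{-1}(1-x)^{-1})$ for $x\in(0,1)$ and $w(x)=0$ for $x\notin(0,1)$, and $A_N=\sum_{n=0}^{N-1}w(n/N)$ (positive for $N\geq2$). As $N\to+\infty$, $f_1(N)=\mathcal{O}(f_2(N))$ means $|f_1(N)|\leq cf_2(N)$ for some constant $c>0$.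
   Formalization: The constants in (II) and (III) are not absolute, which would be false: c_II may depend on f and on the Diophantine constant C (not on ρ), c_III may depend on f and ρ; all are independent of N and θ, and c_I is absolute. *)

(* Defs.v *)
From HB Require Import structures.
From mathcomp Require Import all_boot all_order all_algebra.
From mathcomp Require Import finmap complex.
From mathcomp Require Import all_classical all_reals all_analysis.
From mathcomp Require Import showcase.summability.

Set Implicit Arguments.
Unset Strict Implicit.
Unset Printing Implicit Defensive.

Import Order.TTheory GRing.Theory Num.Theory.
Import numFieldNormedType.Exports.

Local Open Scope classical_set_scope.
Local Open Scope ring_scope.

Section Weight.
Context {R : realType}.
Implicit Type x : R.

Definition weight_profile x : R :=
  if (0 < x) && (x < 1) then expR (- (x^-1 * (1 - x)^-1)) else 0.

Definition weight x : R :=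
  (\int[lebesgue_measure]_(s in `[0%R, 1%R]) weight_profile s)^-1 * weight_profile x.

Definition weight_sum (N : nat) : R := \sum_(0 <= n < N) weight (n%:R / N%:R).

End Weight.

(* Points of the torus R^d / Z^d are given by representatives x : 'rV[R]_d, and
   functions on the torus by Z^d-periodic functions on 'rV[R]_d. *)
Section Torus.
Context {R : realType} {d : nat}.
Implicit Types (x theta rho : 'rV[R]_d) (k : 'rV[int]_d) (f : 'rV[R]_d -> R[i]).

Definition Zd_periodic f : Prop :=
  forall x k, f (x + map_mx intr k) = f x.

Definition dotZ k x : R := \sum_(i < d) (k 0 i)%:~R * x 0 i.

Definition fracpart (t : R) : R := t - (Num.floor t)%:~R.

Definition rotation rho theta : 'rV[R]_d :=
  \row_i fracpart (theta 0 i + rho 0 i).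

Definition monomial (alpha : {ffun 'I_d -> nat}) x : R :=
  \prod_(i < d) x 0 i ^+ alpha i.

(* Near every point, f is the unconditional sum (limit over the directed set of
   finite sets of multi-indices) of a power series with complex coefficients. *)
Definition analytic f : Prop :=
  forall a, exists2 r : R, 0 < r &
    exists c : {ffun 'I_d -> nat} -> R[i], forall x, `|x - a| < r ->
      partial_sum (fun alpha => c alpha * (monomial alpha (x - a))%:C%C)
        @ totally --> (f x : R[i]^o).

Definition cexp2pi (t : R) : R[i] :=
  (cos (2 * pi * t) +i* sin (2 * pi * t))%C.

Definition trig_polynomial f : Prop :=
  exists (K : seq 'rV[int]_d) (c : 'rV[int]_d -> R[i]),
    forall x, f x = \sum_(k <- K) c k * cexp2pi (dotZ k x).

Definition is_normZ (nrm : 'rV[int]_d -> R) : Prop :=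
  [/\ forall k, nrm k = 0 -> k = 0,
      forall k l, nrm (k + l) <= nrm k + nrm l &
      forall (m : int) k, nrm (m *: k) = `|m|%:~R * nrm k].

Definition diophantine (nrm : 'rV[int]_d -> R) (C : R) rho : Prop :=
  forall k, k != 0 -> forall n : int,
    `|dotZ k rho - n%:~R| > C / nrm k ^+ d.

End Torus.

Section TorusMeasure.
Context {R : realType}.

Local Notation mR := (measurableTypeR R).

Definition cons_tuple (n : nat) (p : mR * n.-tuple mR) : n.+1.-tuple mR :=
  [tuple of p.1 :: p.2].

Lemma measurable_cons_tuple n : measurable_fun setT (@cons_tuple n).
Proof. exact: measurable_cons measurable_fst measurable_snd. Qed.

HB.instance Definition _ n := isMeasurableFun.Build _ _ _ _
  (@cons_tuple n) (@measurable_cons_tuple n).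

(* Lebesgue measure on [0, 1]^n, i.e. the n-fold product of the Lebesgue measure
   on [0, 1]; the measurable structure lives on tuples rather than row vectors. *)
Fixpoint cube_measure (n : nat) : probability (n.-tuple mR) R :=
  match n with
  | 0 => dirac [tuple]
  | m.+1 => distribution (uniform_prob (@ltr01 R) \x cube_measure m)%E
              (cons_tuple (n := m))
  end.

Definition row_of_tuple (d : nat) (t : d.-tuple mR) : 'rV[R]_d :=
  \row_i tnth t i.

Definition torus_integral (d : nat) (f : 'rV[R]_d -> R[i]) : R[i] :=
  ((\int[cube_measure d]_t complex.Re (f (row_of_tuple t))) +i*
   (\int[cube_measure d]_t complex.Im (f (row_of_tuple t))))%C.

Definition almost_all_rotations (d : nat) (P : 'rV[R]_d -> Prop) : Prop :=
  {ae cube_measure d, forall t, P (row_of_tuple t)}.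

End TorusMeasure.

Section BirkhoffError.
Context {R : realType} {d : nat}.

Definition Error (f : 'rV[R]_d -> R[i]) (rho theta : 'rV[R]_d) (N : nat) : R :=
  Normc.normc
    ((weight_sum N)^-1%:C%C *
       (\sum_(0 <= n < N) (weight (n%:R / N%:R))%:C%C *
          f (iter n (rotation rho) theta))
     - torus_integral f).

Definition uniform_bigO (E : 'rV[R]_d -> nat -> R) (g : nat -> R) : Prop :=
  exists2 M : R, 0 < M &
    \forall N \near \oo, forall theta, `|E theta N| <= M * g N.

End BirkhoffError.

(* Main.v *)
(* The k-th Fourier mode contributes c_k times the weighted average of exp(2 pi i n a),
   a = k.rho. Since exp(- 1 / (x (1 - x))) is of Gevrey class 2, its m-th differences of
   step 1/N are at most (C m^2 / N)^m, and m summations by parts with m of order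
   sqrt (N dist(a, Z)) bound this average by C exp(- c sqrt (N dist(a, Z))). For
   analytic f the c_k decay like exp(- lam |k|), so one splits the modes at |k| = X and
   chooses X so that the small divisors of the modes |k| <= X are at least of order X^2 / N.
   Almost every rotation satisfies |k.rho - n| >= c |k|^(-d) (ln |k|)^(-zeta) for every
   zeta > 1, by Borel-Cantelli over dyadic ranges of |k|.
   Neither Fourier series nor derivatives of f are used: f is replaced by its
   trigonometric interpolants on finer and finer grids, and the coefficients of these are
   bounded, uniformly in the grid, through the differences of f, which inherit Cauchy-type
   bounds from the local power series. *)
Require Import Defs.
From HB Require Import structures.
From mathcomp Require Import all_boot all_order all_algebra.
From mathcomp Require Import complex finmap showcase.summability.
From mathcomp Require Import all_classical all_reals all_analysis.
From mathcomp Require Import measurable_realfun.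
From mathcomp Require Import ring lra zify.
Set Implicit Arguments.
Unset Strict Implicit.
Unset Printing Implicit Defensive.
Import Order.TTheory GRing.Theory Num.Theory.
Import numFieldNormedType.Exports.
Local Open Scope classical_set_scope.
Local Open Scope ring_scope.

(** * Modulus of complex numbers and the character exp(2 pi i t) *)

(** No Fourier coefficient of [f] itself ever appears. What is extracted from analyticity is that,
    for every [eps], some finite trigonometric sum is uniformly within [eps] of [f], with one bound
    on the sums of |c_k| exp(lam |k|) valid for all [eps]. For fixed [N], [rho] and [theta] the
    error is compared with that of such a sum, whose torus integral is its constant term, and [eps]
    tends to 0 at the end. Differences suit the discrete averages: those of the weight are bounded
    with first derivatives only, by the mean value theorem and an induction inside a family of
    functions closed under derivation. In (II) the constant depends on [f], the norm and [C], but
    not on the rotation; in (III) it depends on the rotation. In (I) it is 1 for all [f] and almost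
    all rotations: the estimate is proved with an exponent 1 + s < zeta of the logarithm, and the
    surplus power of ln N outweighs every constant depending on [f] or the rotation. *)

Local Notation normc := (@Normc.normc _).

Section ComplexModulus.
Context {R : realType}.
Implicit Types (z u : R[i]) (s t a : R).

Lemma normc_ge0 z : 0 <= normc z.
Proof. by case: z => x y; rewrite /Normc.normc sqrtr_ge0. Qed.

Lemma normc_triangle z u : normc (z + u) <= normc z + normc u.
Proof. exact: le_normcD. Qed.

Lemma normc_opp z : normc (- z) = normc z.
Proof. exact: normcN. Qed.

Lemma normc_real t : normc t%:C%C = `|t|.
Proof. by rewrite /Normc.normc /= expr0n /= addr0 sqrtr_sqr. Qed.

Lemma normc_sum (I : Type) (r : seq I) (P : pred I) (F : I -> R[i]) :
  normc (\sum_(i <- r | P i) F i) <= \sum_(i <- r | P i) normc (F i).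
Proof.
elim/big_ind2: _ => // [|z a u b za ub]; first by rewrite Normc.normc0.
by rewrite (le_trans (normc_triangle _ _)) // lerD.
Qed.

Lemma normc_exp z n : normc (z ^+ n) = normc z ^+ n.
Proof.
elim: n => [|n IHn]; first by rewrite !expr0 Normc.normc1.
by rewrite !exprS Normc.normcM IHn.
Qed.

Lemma normc_Re z : `|complex.Re z| <= normc z.
Proof.
case: z => x y /=; rewrite -sqrtr_sqr ler_wsqrtr // lerDl sqr_ge0 //.
Qed.

Lemma normc_Im z : `|complex.Im z| <= normc z.
Proof.
case: z => x y /=; rewrite -sqrtr_sqr ler_wsqrtr // lerDr sqr_ge0 //.
Qed.

Lemma normc_ReIm z : normc z <= `|complex.Re z| + `|complex.Im z|.
Proof.
rewrite {1}[z]complexE (le_trans (normc_triangle _ _)) // Normc.normcM !normc_real.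
by rewrite /Normc.normc /= expr0n /= expr1n add0r sqrtr1 mul1r.
Qed.

Lemma cexp2piD s t : cexp2pi (s + t) = cexp2pi s * cexp2pi t.
Proof.
rewrite /cexp2pi mulrDr cosD sinD; apply/eqP; rewrite eq_complex /= eqxx /=.
by apply/eqP; ring.
Qed.

Lemma cexp2pi0 : cexp2pi 0 = 1 :> R[i].
Proof. by rewrite /cexp2pi mulr0 cos0 sin0. Qed.

Lemma normc_cexp2pi t : normc (cexp2pi t) = 1.
Proof. by rewrite /Normc.normc /= cos2Dsin2 sqrtr1. Qed.

Lemma cexp2pi_nat (n : nat) : cexp2pi n%:R = 1 :> R[i].
Proof.
elim: n => [|n IHn]; first exact: cexp2pi0.
by rewrite -addn1 natrD cexp2piD IHn mul1r /cexp2pi mulr1 mulr_natl cos2pi sin2pi.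
Qed.

Lemma cexp2piN t : cexp2pi t * cexp2pi (- t) = 1.
Proof. by rewrite -cexp2piD subrr cexp2pi0. Qed.

Lemma cexp2pi_int (n : int) : cexp2pi n%:~R = 1 :> R[i].
Proof.
case: n => n; first exact: cexp2pi_nat.
by rewrite NegzE mulrNz -[LHS]mul1r -[X in X * _](cexp2pi_nat n.+1) cexp2piN.
Qed.

Lemma cexp2pi_periodic t (n : int) : cexp2pi (t + n%:~R) = cexp2pi t.
Proof. by rewrite cexp2piD cexp2pi_int mulr1. Qed.

Lemma normc_1Bcexp2pi a : normc (1 - cexp2pi a) = 2 * `|sin (pi * a)|.
Proof.
rewrite /Normc.normc /=.
have -> : 2 * pi * a = (pi * a) *+ 2 by rewrite -mulr_natl; ring.
rewrite cos_mulr2n sin_mulr2n.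
have := cos2Dsin2 (pi * a); set c := cos _; set s := sin _ => cs.
rewrite -[RHS]ger0_norm ?mulr_ge0 // -[X in _ = X]sqrtr_sqr; congr Num.sqrt.
rewrite exprMn real_normK ?num_real //.
have -> : c ^+ 2 = 1 - s ^+ 2 by rewrite -cs addrK.
rewrite -mulr_natl sub0r sqrrN.
have -> : (c * s *+ 2) ^+ 2 = 4 * (1 - s ^+ 2) * s ^+ 2.
  rewrite -[c * s *+ 2]mulr_natl (_ : 1 - s ^+ 2 = c ^+ 2); [ring|by rewrite -cs addrK].
ring.
Qed.

Lemma abs_sin_le a : `|sin a| <= `|a|.
Proof.
wlog a0 : a / 0 <= a.
  move=> H; have [/H //|a0] := leP 0 a.
  by rewrite -normrN -sinN -(normrN a); apply: H; rewrite oppr_ge0 ltW.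
have [c _] := MVT_segment a0 (fun x _ => is_derive_sin x)
  (continuous_subspaceT (@continuous_sin R)).
rewrite sin0 !subr0 => ->.
by rewrite normrM ler_piMl // ler_norml cos_geN1 cos_le1.
Qed.

Lemma normc_cexp2pi_lip s t : normc (cexp2pi s - cexp2pi t) <= 2 * pi * `|s - t|.
Proof.
have -> : cexp2pi s - cexp2pi t = cexp2pi s * (1 - cexp2pi (t - s)).
  by rewrite mulrBr mulr1 -cexp2piD (addrC s) subrK.
rewrite Normc.normcM normc_cexp2pi mul1r normc_1Bcexp2pi -mulrA ler_pM2l //.
by rewrite (le_trans (abs_sin_le _)) // normrM distrC ger0_norm // pi_ge0.
Qed.

Lemma sin_ge_mul_cos a : 0 <= a <= pi / 2 -> a * cos a <= sin a.
Proof.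
move=> /andP[a0 ap].
have [c] := MVT_segment a0 (fun x _ => is_derive_sin x)
  (continuous_subspaceT (@continuous_sin R)).
rewrite in_itv /= sin0 !subr0 => /andP[c0 ca] ->.
rewrite mulrC ler_wpM2r // leNgt ltr_cos ?in_itv /= ?a0 ?c0 /=.
- by rewrite -leNgt.
- by have := pi_ge0 R; lra.
- by have := pi_ge0 R; lra.
Qed.

(** Halving the angle leads to b = pi a / 2 <= pi / 4, where cos^2 b >= 1/2; hence sin (2 b) = 2 sin
    b cos b >= 2 b cos^2 b >= b, and b >= a because pi >= 2. *)
Lemma sin_pi_ge a : 0 <= a <= 2^-1 -> a <= sin (pi * a).
Proof.
move=> /andP[a0 a1].
have p2 := pi_ge2 R.
have -> : pi * a = (pi * a / 2) *+ 2 by rewrite -mulr_natl; field.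
rewrite sin_mulr2n.
set b := pi * a / 2.
have b0 : 0 <= b by rewrite /b divr_ge0 // mulr_ge0 // pi_ge0.
have bp : b <= pi / 4.
  have -> : pi / 4 = pi / 2 * 2^-1 :> R by field.
  rewrite /b mulrAC ler_wpM2l //; lra.
have cb : cos (pi / 4) <= cos b.
  rewrite leNgt ltr_cos ?in_itv /= ?b0 /=; [by rewrite -leNgt|lra|lra].
have c4 : cos (pi / 4) ^+ 2 = 2^-1 :> R.
  have : cos (pi / 4 *+ 2) = 0 :> R.
    by rewrite -mulr_natl (_ : 2 * (pi / 4) = pi / 2) ?cos_pihalf //; field.
  rewrite cos_mulr2n -mulr_natl => h; lra.
have c40 : 0 <= cos (pi / 4) :> R by apply: cos_ge0_pihalf; lra.
have sb : b * cos b <= sin b by apply: sin_ge_mul_cos; lra.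
have cc : 2^-1 <= cos b ^+ 2 by rewrite -c4 ler_pXn2r ?nnegrE // (le_trans c40).
have b2 : a <= b by rewrite /b; nra.
have : b * cos b * cos b <= cos b * sin b.
  by rewrite [leRHS]mulrC ler_wpM2r // (le_trans c40).
rewrite -mulrA -expr2 -mulr_natl => h; nra.
Qed.

Lemma normc_1Bcexp2pi_ge a delta :
  (forall n : int, delta <= `|a - n%:~R|) -> 2 * delta <= normc (1 - cexp2pi a).
Proof.
(* The integer nearest to [a], so that [a - n] lies in [-1/2, 1/2). *)
move=> H; pose n := Num.floor (a + 2^-1).
have /andP[n1 n2] : n%:~R <= a + 2^-1 < n%:~R + 1 by have := floor_itv (a + 2^-1); rewrite intrD.
pose b := a - n%:~R.
have -> : cexp2pi a = cexp2pi b by rewrite /b -mulrNz cexp2pi_periodic.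
rewrite normc_1Bcexp2pi ler_pM2l // (le_trans (H n)) // -/b.
have [b0|b0] := leP 0 b.
  rewrite (ger0_norm b0) (le_trans _ (ler_norm _)) // sin_pi_ge // b0 /= /b; lra.
rewrite -(normrN (sin _)) -sinN -mulrN (ltr0_norm b0) (le_trans _ (ler_norm _)) //.
by rewrite sin_pi_ge // oppr_ge0 ltW //= /b; lra.
Qed.

End ComplexModulus.

(** * Backward differences *)

Section BackwardDifference.

Definition bdiff (V W : zmodType) (v : V) (g : V -> W) : V -> W :=
  fun x => g x - g (x - v).

Lemma bdiff_iterSr (V W : zmodType) (v : V) (g : V -> W) m x :
  iter m.+1 (bdiff v) g x = iter m (bdiff v) g x - iter m (bdiff v) g (x - v).
Proof. by []. Qed.

Lemma eq_bdiff_iter (V W : zmodType) (v : V) (g g' : V -> W) m :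
  g =1 g' -> iter m (bdiff v) g =1 iter m (bdiff v) g'.
Proof. by move=> /funext ->. Qed.

Lemma bdiff_iterD (V W : zmodType) (v : V) (g g' : V -> W) m x :
  iter m (bdiff v) (fun y => g y + g' y) x =
  iter m (bdiff v) g x + iter m (bdiff v) g' x.
Proof.
elim: m x => // m IHm x; rewrite !bdiff_iterSr !IHm opprD addrACA //.
Qed.

Lemma bdiff_iter0 (V W : zmodType) (v : V) m x :
  iter m (bdiff v) (fun=> 0 : W) x = 0.
Proof. by elim: m x => // m IHm x; rewrite bdiff_iterSr !IHm subrr. Qed.

Lemma bdiff_iter_sum (V W : zmodType) (v : V) (I : Type) (r : seq I) (g : I -> V -> W) m x :
  iter m (bdiff v) (fun y => \sum_(i <- r) g i y) x =
  \sum_(i <- r) iter m (bdiff v) (g i) x.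
Proof.
elim: m x => // m IHm x; rewrite bdiff_iterSr !IHm -sumrB.
by apply: eq_bigr.
Qed.

Lemma bdiff_iterZ (V : zmodType) (W : pzRingType) (v : V) (c : W) (g : V -> W) m x :
  iter m (bdiff v) (fun y => c * g y) x = c * iter m (bdiff v) g x.
Proof. by elim: m x => // m IHm x; rewrite !bdiff_iterSr !IHm mulrBr. Qed.

(** A factor invariant under the step comes out of the differences. This reduces coordinate
    differences of a monomial to differences of one power of one variable. *)
Lemma bdiff_iter_comp (U V : zmodType) (W : pzRingType) (u : U) (v : V)
    (P : U -> W) (l : U -> V) (g : V -> W) m x :
  (forall y, P (y - u) = P y) -> (forall y, l (y - u) = l y - v) ->
  iter m (bdiff u) (fun y => P y * g (l y)) x = P x * iter m (bdiff v) g (l x).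
Proof.
move=> Pu lu; elim: m x => // m IHm x.
by rewrite !bdiff_iterSr !IHm Pu lu mulrBr.
Qed.

Context {R : realType}.
Implicit Types (F dF : R -> R) (h x s K tau : R).

Lemma is_derive_bdiff F dF h : (forall s, is_derive s 1 F (dF s)) ->
  forall s, is_derive s 1 (bdiff h F) (bdiff h dF s).
Proof.
move=> FdF s; rewrite /bdiff.
apply: (@is_deriveB _ _ _ F (F \o (fun t => t - h)) s 1) => //.
rewrite -[dF (s - h)]mulr1; apply: is_derive1_comp.
exact: (is_derive_shift s 1 (- h)).
Qed.

Lemma is_derive_bdiff_iter F dF h m : (forall s, is_derive s 1 F (dF s)) ->
  forall s, is_derive s 1 (iter m (bdiff h) F) (iter m (bdiff h) dF s).
Proof. by move=> FdF; elim: m => // m IHm s; exact: is_derive_bdiff. Qed.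

Lemma bdiff_le F dF h x K : 0 <= h -> (forall s, is_derive s 1 F (dF s)) ->
  (forall s, x - h <= s <= x -> `|dF s| <= K) -> `|bdiff h F x| <= h * K.
Proof.
move=> h0 FdF FK.
have Fc : {within `[x - h, x], continuous F}.
  apply: continuous_subspaceT => s; apply/differentiable_continuous.
  by apply/derivable1_diffP; case: (FdF s).
have xh : x - h <= x by rewrite gerBl.
have [c] := MVT_segment xh (fun s _ => FdF s) Fc.
rewrite in_itv /= => cx; rewrite /bdiff => ->.
rewrite opprB addrC subrK normrM mulrC (ger0_norm h0) ler_wpM2l //.
exact: FK.
Qed.

(** Differences commute with derivation, so one difference is traded for one derivative and a factor
    [h]. Iterated, this bounds differences of any order without higher derivatives. *)
Lemma bdiff_iterS_le F dF h m x K : 0 <= h -> (forall s, is_derive s 1 F (dF s)) ->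
  (forall s, x - h <= s <= x -> `|iter m (bdiff h) dF s| <= K) ->
  `|iter m.+1 (bdiff h) F x| <= h * K.
Proof. by move=> h0 FdF; apply: bdiff_le => //; exact: is_derive_bdiff_iter. Qed.

(** The bound is [h ^+ m] times that of the m-th derivative on [-tau, tau]. It suffices to control
    the two extreme points, the interval being convex. For m > n the falling factorial vanishes, so
    the truncated exponent [n - m] is harmless. *)
Lemma bdiff_exp_le n m x h tau : 0 <= h -> `|x| <= tau -> `|x - m%:R * h| <= tau ->
  `|iter m (bdiff h) (fun t => t ^+ n) x| <= (n ^_ m)%:R * h ^+ m * tau ^+ (n - m).
Proof.
move=> h0; elim: m n x => [|m IHm] n x xt xmt.
  by rewrite /= ffactn0 !mul1r subn0 normrX lerXn2r ?nnegrE // (le_trans _ xt).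
case: n => [|n].
  rewrite ffact0n !mul0r (@eq_bdiff_iter _ _ _ _ (fun=> 1)) //.
  by rewrite iterSr (_ : bdiff _ _ = fun=> 0) ?bdiff_iter0 ?normr0 //; apply/funext => t; rewrite /bdiff subrr.
have dX s : is_derive s 1 (fun t : R => t ^+ n.+1) (n.+1%:R * s ^+ n).
  have := @is_deriveX _ _ (@id R) n.+1 s 1 1 (is_derive_id _ _).
  rewrite exprfctE => H; apply: (is_derive_eq H _).
  by rewrite /= /GRing.scale /= mulr1.
rewrite ffactSS subSS natrM exprS.
rewrite (_ : _ * tau ^+ _ = h * (n.+1%:R * ((n ^_ m)%:R * h ^+ m * tau ^+ (n - m)))); last by ring.
apply: (bdiff_iterS_le h0 dX) => s /andP[s1 s2].
rewrite bdiff_iterZ normrM ger0_norm // ler_wpM2l // IHm //.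
  move: xt xmt; rewrite -natr1 mulrDl mul1r !ler_norml.
  have := mulr_ge0 (ler0n R m) h0; lra.
move: xt xmt; rewrite -natr1 mulrDl mul1r !ler_norml.
have := mulr_ge0 (ler0n R m) h0; lra.
Qed.

End BackwardDifference.

(** * The weight *)

Section WeightProfile.
Context {R : realType}.
Implicit Types (t x h : R).

(* The span of these functions is stable under derivation. *)
Definition profile_pow (a b : nat) t : R :=
  if (0 < t) && (t < 1)
  then t^-1 ^+ a * (1 - t)^-1 ^+ b * expR (- (t^-1 * (1 - t)^-1)) else 0.

Definition dprofile_pow (a b : nat) t : R :=
  (- a%:R) * profile_pow a.+1 b t + b%:R * profile_pow a b.+1 t +
  (profile_pow a.+2 b t + (- 1) * profile_pow a b.+2 t).

Lemma profile_pow00 t : profile_pow 0 0 t = weight_profile t.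
Proof. by rewrite /profile_pow /weight_profile !expr0 !mul1r. Qed.

Lemma exp_le_fact_expR n x : 0 <= x -> x ^+ n <= n`!%:R * expR x.
Proof.
move=> x0; case: n => [|n].
  by rewrite expr0 fact0 mul1r -(expR0 R) ler_expR.
have := expR_ge1Dxn n x0.
have f0 : (0 : R) < n.+1`!%:R by rewrite ltr0n fact_gt0.
move=> H; rewrite -ler_pdivrMl // mulrC; apply: le_trans H; lra.
Qed.

(** With u = 1/t and v = 1/(1 - t) one has u v = u + v, so the function splits as u^a exp(-u) v^b
    exp(-v) <= a! b! <= (a + b)!. *)
Lemma profile_pow_le_uv a b t : 0 < t < 1 ->
  `|profile_pow a b t| <= (a + b)`!%:R.
Proof.
move=> /andP[t0 t1]; rewrite /profile_pow t0 t1 /=.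
have v0 : 0 < 1 - t by lra.
have -> : t^-1 * (1 - t)^-1 = t^-1 + (1 - t)^-1 by field; rewrite ?gt_eqF.
set u := t^-1; set v := (1 - t)^-1.
have u0 : 0 < u by rewrite invr_gt0.
have {}v0 : 0 < v by rewrite invr_gt0.
rewrite ger0_norm ?mulr_ge0 ?exprn_ge0 ?expR_ge0 ?(ltW u0) ?(ltW v0) //.
rewrite expRN ler_pdivrMr ?expR_gt0 // expRD.
have Hu := exp_le_fact_expR a (ltW u0); have Hv := exp_le_fact_expR b (ltW v0).
apply: (le_trans (ler_pM _ _ Hu Hv)); rewrite ?exprn_ge0 ?(ltW u0) ?(ltW v0) //.
rewrite mulrACA ler_wpM2r ?mulr_ge0 ?expR_ge0 //.
rewrite -natrM ler_nat -(bin_fact (leq_addr b a)) addKn.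
by rewrite leq_pmull // bin_gt0 leq_addr.
Qed.

Lemma profile_pow_out a b t : t <= 0 \/ 1 <= t -> profile_pow a b t = 0.
Proof. by rewrite /profile_pow => -[t0|t1]; case: ifP => // /andP[]; lra. Qed.

Lemma profile_pow_bound a b t : `|profile_pow a b t| <= (a + b)`!%:R.
Proof.
have [/profile_pow_le_uv //|] := boolP (0 < t < 1).
by rewrite /profile_pow => /negbTE ->; rewrite normr0.
Qed.

(** Two more powers of 1/t still give a bounded function. The resulting second order vanishing at 0,
    and by symmetry at 1, makes the derivative exist and vanish at the junction points. *)
Lemma profile_pow_sq0 a b t : 0 < t -> `|profile_pow a b t| <= (a + b).+2`!%:R * t ^+ 2.
Proof.
move=> t0; have := profile_pow_bound a.+2 b t.
rewrite !addSn => H; rewrite -ler_pdivrMr ?exprn_gt0 //; apply: le_trans H.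
rewrite /profile_pow; case: ifP => _; last by rewrite normr0 mul0r.
rewrite !exprS !normrM !normfV (gtr0_norm t0) expr0 mulr1 invfM.
move: t^-1 `|_ ^+ a| `|_ ^+ b| `|expR _| => i p q r.
by rewrite (_ : p * q * r * (i * i) = i * (i * p) * q * r) //; ring.
Qed.

Lemma profile_pow_sym a b t : profile_pow a b t = profile_pow b a (1 - t).
Proof.
rewrite /profile_pow subr_gt0 gtrBl andbC; case: ifP => // _.
rewrite (_ : 1 - (1 - t) = t); last by ring.
by rewrite [(1 - t)^-1 * t^-1]mulrC [(1 - t)^-1 ^+ b * _]mulrC.
Qed.

Lemma is_derive_flat (F : R -> R) c C : F c = 0 ->
  (forall t, `|F (t + c)| <= C * t ^+ 2) -> is_derive c 1 F 0.
Proof.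
move=> Fc FC.
have C0 : 0 <= C by have := FC 1; rewrite expr1n mulr1; apply: le_trans.
have L : h^-1 *: ((F \o shift c) (h *: 1) - F c) @[h --> 0^'] --> (0 : R).
  apply/cvgrPdist_le => e e0.
  have e1 : 0 < e / (C + 1) by rewrite divr_gt0 //; lra.
  near=> h.
  have hn0 : h != 0 by near: h; exact: nbhs_dnbhs_neq.
  have he : `|h| <= e / (C + 1) by near: h; exact: dnbhs0_le.
  rewrite sub0r normrN Fc subr0 /= /GRing.scale /= mulr1 normrM normfV.
  rewrite ler_pdivrMl ?normr_gt0 // (le_trans (FC h)) //.
  rewrite -real_normK ?num_real // expr2 mulrA [leRHS]mulrC ler_wpM2r //.
  move: he; rewrite ler_pdivlMr; last by lra.
  have := normr_ge0 h; nra.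
have Dc : derivable F c 1 by apply/cvg_ex; exists 0.
by apply: (DeriveDef Dc); exact: cvg_lim.
Unshelve. all: by end_near. Qed.

(** The relation u v = u + v turns the derivative of the exponent, u v (u - v), into u^2 - v^2. The
    result thus stays in the span of the same products, with total degree raised by at most 2. *)
Lemma is_derive_profile_in (u v : R -> R) a b t :
  is_derive t 1 u (- (u t) ^+ 2) -> is_derive t 1 v ((v t) ^+ 2) ->
  u t * v t = u t + v t ->
  is_derive t 1 (fun s => u s ^+ a * v s ^+ b * expR (- (u s * v s)))
    ((- a%:R) * (u t ^+ a.+1 * v t ^+ b * expR (- (u t * v t))) +
     b%:R * (u t ^+ a * v t ^+ b.+1 * expR (- (u t * v t))) +
     (u t ^+ a.+2 * v t ^+ b * expR (- (u t * v t)) +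
     (- 1) * (u t ^+ a * v t ^+ b.+2 * expR (- (u t * v t))))).
Proof.
move=> du dv uv.
have duv := is_deriveN (is_deriveM du dv).
have de := is_derive1_comp (is_derive_expR _) duv.
have dua : is_derive t 1 (fun s => u s ^+ a) (a%:R * u t ^+ a.-1 * - (u t) ^+ 2).
  by have := is_deriveX a du; rewrite exprfctE => H; apply: (is_derive_eq H).
have dvb : is_derive t 1 (fun s => v s ^+ b) (b%:R * v t ^+ b.-1 * (v t) ^+ 2).
  by have := is_deriveX b dv; rewrite exprfctE => H; apply: (is_derive_eq H).
have D := is_deriveM (is_deriveM dua dvb) de.
apply: (is_derive_eq D); rewrite /GRing.scale /=.
rewrite !fctE.
set e := expR _.
have Ea : a%:R * u t ^+ a.-1 * - (u t) ^+ 2 = - (a%:R * u t ^+ a.+1).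
  by case: a {dua D} => [|n]; rewrite ?mul0r ?oppr0 //= mulrN -mulrA -exprD addn2.
have Eb : b%:R * v t ^+ b.-1 * (v t) ^+ 2 = b%:R * v t ^+ b.+1.
  by case: b {dvb D} => [|n]; rewrite ?mul0r //= -mulrA -exprD addn2.
rewrite Ea Eb.
have -> : - (u t * v t ^+ 2 + v t * - u t ^+ 2) = u t ^+ 2 - v t ^+ 2.
  have -> : - (u t * v t ^+ 2 + v t * - u t ^+ 2) = u t * v t * (u t - v t) by ring.
  by rewrite uv; ring.
by rewrite [u t ^+ a.+2]exprS [u t ^+ a.+1]exprS [v t ^+ b.+2]exprS [v t ^+ b.+1]exprS; ring.
Qed.

Lemma is_derive_profile_pow a b t :
  is_derive t 1 (profile_pow a b) (dprofile_pow a b t).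
Proof.
have [t0|t0] := leP t 0.
  rewrite /dprofile_pow !(fun a b => profile_pow_out a b (or_introl t0)).
  rewrite !mulr0 !addr0; apply: (@is_derive_flat _ _ (a + b).+2`!%:R).
    by rewrite profile_pow_out //; left.
  move=> s; have [st|st] := leP (s + t) 0.
    by rewrite (profile_pow_out _ _ (or_introl st)) normr0 mulr_ge0 ?sqr_ge0 ?ler0n.
  apply: (le_trans (profile_pow_sq0 a b st)); rewrite ler_wpM2l //.
  by rewrite ler_pXn2r ?nnegrE //; lra.
have [t1|t1] := leP 1 t.
  rewrite /dprofile_pow !(fun a b => profile_pow_out a b (or_intror t1)).
  rewrite !mulr0 !addr0; apply: (@is_derive_flat _ _ (b + a).+2`!%:R).
    by rewrite profile_pow_out //; right.
  move=> s; have [st|st] := leP 1 (s + t).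
    by rewrite (profile_pow_out _ _ (or_intror st)) normr0 mulr_ge0 ?sqr_ge0 ?ler0n.
  rewrite profile_pow_sym.
  apply: (le_trans (@profile_pow_sq0 b a (1 - (s + t)) _)); first by lra.
  rewrite ler_wpM2l //.
  by rewrite -(sqrrN s) ler_pXn2r ?nnegrE //; lra.
have t01 : t \in `]0, 1[ by rewrite in_itv /= t0.
pose G (s : R) := s^-1 ^+ a * (1 - s)^-1 ^+ b * expR (- (s^-1 * (1 - s)^-1)).
have GF : \forall s \near t, G s = profile_pow a b s.
  near=> s; rewrite /profile_pow ifT //.
  by have : s \in `]0, 1[ by near: s; exact: near_in_itvoo.
apply: (near_eq_is_derive GF).
rewrite /dprofile_pow /profile_pow t0 t1 /=.
apply: (@is_derive_profile_in (fun s => s^-1) (fun s => (1 - s)^-1)).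
- have := @is_deriveV _ (@id R) t 1 1 (lt0r_neq0 t0) (is_derive_id _ _).
  by move=> H; apply: (is_derive_eq H); rewrite /GRing.scale /= mulr1 exprVn.
- have d1 : is_derive t 1 (fun s : R => 1 - s) (- 1).
    have := @is_deriveB _ _ _ (cst 1 : R -> R) id t 1 _ _ (is_derive_cst _ _ _) (is_derive_id _ _).
    by rewrite sub0r.
  have n0 : 1 - t != 0 by rewrite gt_eqF // subr_gt0.
  have := @is_deriveV _ (fun s : R => 1 - s) t _ 1 n0 d1.
  by move=> H; apply: (is_derive_eq H); rewrite /GRing.scale /= mulrN1 opprK exprVn.
- by field; rewrite !gt_eqF //; lra.
Unshelve. all: by end_near. Qed.

(** Gevrey class 2 in the form of differences. With n = a + b + 2 m, one derivation produces terms
    of total weight a + b bounded through (n + 1)! and two terms bounded through (n + 2)!. Since a +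
    b <= n + 2, the sum is at most 3 (n + 2)!, which is the origin of the 3. *)
Lemma bdiff_profile_pow_le m a b h t : 0 <= h ->
  `|iter m (bdiff h) (profile_pow a b) t| <= (h * 3) ^+ m * (a + b + 2 * m)`!%:R.
Proof.
move=> h0; elim: m a b t => [|m IHm] a b t.
  by rewrite mul1r muln0 addn0; exact: profile_pow_bound.
rewrite exprS -!mulrA; apply: (bdiff_iterS_le h0 (is_derive_profile_pow a b)) => s _.
rewrite /dprofile_pow !bdiff_iterD !bdiff_iterZ.
set n := (a + b + 2 * m)%N.
have E1 : (a.+1 + b + 2 * m)%N = n.+1 by rewrite /n; lia.
have E2 : (a + b.+1 + 2 * m)%N = n.+1 by rewrite /n; lia.
have E3 : (a.+2 + b + 2 * m)%N = n.+2 by rewrite /n; lia.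
have E4 : (a + b.+2 + 2 * m)%N = n.+2 by rewrite /n; lia.
have -> : (a + b + 2 * m.+1)%N = n.+2 by rewrite /n; lia.
have := IHm a.+1 b s; have := IHm a b.+1 s; have := IHm a.+2 b s; have := IHm a b.+2 s.
rewrite E1 E2 E3 E4.
set H := (h * 3) ^+ m; set Y1 := iter _ _ _ _; set Y2 := iter _ _ _ _.
set Y3 := iter _ _ _ _; set Y4 := iter _ _ _ _.
have H0 : 0 <= H by rewrite exprn_ge0 // mulr_ge0.
have ab : a%:R + b%:R <= n.+2%:R :> R by rewrite -natrD ler_nat /n; lia.
have -> : n.+2`!%:R = n.+2%:R * n.+1`!%:R :> R by rewrite factS natrM.
set f := n.+1`!%:R; have f0 : 0 <= f :> R by rewrite /f.
have a0 : 0 <= a%:R :> R by []. 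
have b0 : 0 <= b%:R :> R by [].
move=> y1 y2 y3 y4.
have z4 : `|- a%:R * Y4| <= a%:R * (H * f) by rewrite mulNr normrN normrM ger0_norm // ler_wpM2l.
have z3 : `|b%:R * Y3| <= b%:R * (H * f) by rewrite normrM ger0_norm // ler_wpM2l.
have z1 : `|- 1 * Y1| <= H * (n.+2%:R * f) by rewrite mulN1r normrN.
have z : (a%:R + b%:R) * (H * f) <= n.+2%:R * (H * f).
  by rewrite ler_wpM2r // mulr_ge0.
apply: (le_trans (ler_normD _ _)); apply: (le_trans (lerD (ler_normD _ _) (ler_normD _ _))).
have -> : 3 * (H * (n.+2%:R * f)) = n.+2%:R * (H * f) + (H * (n.+2%:R * f) + H * (n.+2%:R * f)) by ring.
apply: lerD; last exact: lerD.
apply: le_trans z; rewrite mulrDl; exact: lerD.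
Qed.

Lemma bdiff_profile_out m h t : 0 <= h -> t <= 0 \/ 1 + m%:R * h <= t ->
  iter m (bdiff h) weight_profile t = 0.
Proof.
move=> h0; elim: m t => [|m IHm] t.
  by rewrite mul0r addr0 => /(profile_pow_out 0 0); rewrite profile_pow00.
have mh : 0 <= m%:R * h by rewrite mulr_ge0.
rewrite bdiff_iterSr -natr1 mulrDl mul1r => ht; rewrite !IHm ?subrr //.
- by case: ht => ?; [left|right]; lra.
- by case: ht => ?; [left|right]; lra.
Qed.

End WeightProfile.

(** * Weighted exponential sums *)

Section WeightSums.
Context {R : realType}.
Implicit Types (t x h a delta : R).

Lemma weight_profile_ge0 t : 0 <= weight_profile t.
Proof. by rewrite /weight_profile; case: ifP => // _; exact: expR_ge0. Qed.

Lemma weight_profile_ge t : 4^-1 <= t <= 2^-1 -> expR (- 8) <= weight_profile t.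
Proof.
move=> /andP[t1 t2]; rewrite /weight_profile ifT; last by lra.
rewrite ler_expR lerN2 (_ : 8 = 4 * 2); last by rewrite -natrM.
have t0 : 0 < t by lra.
have s0 : 0 < 1 - t by lra.
apply: ler_pM; rewrite ?invr_ge0 ?(ltW t0) ?(ltW s0) //.
  by rewrite -[4]invrK lef_pV2 ?posrE //; lra.
by rewrite -[2]invrK lef_pV2 ?posrE //; lra.
Qed.

Lemma continuous_weight_profile : continuous (@weight_profile R).
Proof.
move=> t; apply/differentiable_continuous/derivable1_diffP.
have [+ _] := is_derive_profile_pow 0 0 t.
by rewrite (_ : profile_pow 0 0 = @weight_profile R) //; apply/funext => s; rewrite profile_pow00.
Qed.

Lemma weight_mass_gt0 :
  0 < \int[lebesgue_measure]_(s in `[0%R, 1%R]) weight_profile s :> R.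
Proof.
have wi : lebesgue_measure.-integrable `[0%R, 1%R] (EFin \o @weight_profile R).
  apply: continuous_compact_integrable; first exact: segment_compact.
  by apply: continuous_subspaceT; exact: continuous_weight_profile.
rewrite /Rintegral fine_gt0 //; apply/andP; split; last first.
  by have := integrable_fin_num _ wi => /(_ (measurable_itv _)); rewrite fin_numE => /andP[_]; rewrite ltey.
apply: (@lt_le_trans _ _ (\int[lebesgue_measure]_(s in `[4^-1%R, 2^-1%R]) (cst (expR (- 8))%:E s))%E).
  rewrite integral_cst //= lebesgue_measure_itv /= lte_fin ifT; last by lra.
  by rewrite -EFinB mule_gt0 // ?lte_fin ?expR_gt0 //; lra.
apply: (@le_trans _ _ (\int[lebesgue_measure]_(s in `[4^-1%R, 2^-1%R]) (weight_profile s)%:E)%E).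
  apply: ge0_le_integral => //.
  - by move=> s _; rewrite lee_fin expR_ge0.
  - apply/measurable_EFinP; apply: measurable_funTS.
    by apply: continuous_measurable_fun; exact: continuous_weight_profile.
  - by move=> s; rewrite /= in_itv /= => hs; rewrite lee_fin weight_profile_ge.
apply: ge0_subset_integral => //.
- by case/integrableP: wi.
- by move=> s _; rewrite lee_fin weight_profile_ge0.
- by move=> s /=; rewrite !in_itv /=; lra.
Qed.

(** Only the indices with N/4 < n <= N/2 are kept: there are at least N/8 of them, and the profile
    is at least exp(-8) there. *)
Lemma weight_profile_sum_ge (N : nat) : (4 <= N)%N ->
  N%:R * (expR (- 8) / 8) <= \sum_(0 <= n < N) weight_profile (n%:R / N%:R : R).
Proof.
move=> N4.
have N0 : (0 : R) < N%:R by rewrite ltr0n; lia.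
rewrite (@big_cat_nat _ _ _ (N %/ 4).+1) //=; last by lia.
rewrite (@big_cat_nat _ _ _ (N %/ 2).+1 (N %/ 4).+1) //=; [|lia|lia].
have -> : N%:R * (expR (- 8) / 8) = 0 + (N%:R / 8 * expR (- 8) + 0) :> R by field.
apply: lerD; first by apply: sumr_ge0 => i _; exact: weight_profile_ge0.
apply: lerD; last by apply: sumr_ge0 => i _; exact: weight_profile_ge0.
apply: (@le_trans _ _ (\sum_((N %/ 4).+1 <= i < (N %/ 2).+1) expR (- 8))).
  rewrite sumr_const_nat -[leRHS]mulr_natl ler_wpM2r ?expR_ge0 //.
  rewrite ler_pdivrMr // -natrM ler_nat; lia.
apply: ler_sum_nat => i /andP[i1 i2].
apply: weight_profile_ge; rewrite ler_pdivlMr // ler_pdivrMr //; apply/andP; split.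
  by rewrite mulrC ler_pdivrMr // -natrM ler_nat; lia.
by rewrite mulrC ler_pdivlMr // -natrM ler_nat; lia.
Qed.

(** The normalising integral is nonzero and cancels, so the averages can be studied with the bare
    profile. *)
Lemma weighted_average_profile (N : nat) (z : nat -> R[i]) :
  (weight_sum N)^-1%:C%C * (\sum_(0 <= n < N) (weight (n%:R / N%:R))%:C%C * z n) =
  (\sum_(0 <= n < N) weight_profile (n%:R / N%:R))^-1%:C%C *
   (\sum_(0 <= n < N) (weight_profile (n%:R / N%:R))%:C%C * z n).
Proof.
have W0 := weight_mass_gt0; rewrite /weight_sum /weight -mulr_sumr.
set W := (\int[_]_(_ in _) _)^-1.
have Wn0 : W != 0 by rewrite /W invr_neq0 // gt_eqF.
rewrite [X in _ * X = _](_ : _ = W%:C%C *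
   (\sum_(0 <= n < N) (weight_profile (n%:R / N%:R))%:C%C * z n)).
  by rewrite mulrA -rmorphM /= invfM mulrAC mulVf // mul1r.
by rewrite mulr_sumr; apply: eq_bigr => n _; rewrite rmorphM mulrA.
Qed.

(** The number [L] of terms is a parameter because the support of the differences grows by one step
    at each order: [L = N + m] covers order [m]. *)
Let exp_sum (m L N : nat) a : R[i] :=
  \sum_(0 <= n < L) (iter m (bdiff N%:R^-1) weight_profile (n%:R / N%:R))%:C%C
    * cexp2pi (n%:R * a).

(* Summation by parts; the boundary terms vanish since the profile is supported in (0, 1). *)
Let exp_sumS m N a : (0 < N)%N ->
  exp_sum m.+1 (N + m.+1) N a = (1 - cexp2pi a) * exp_sum m (N + m) N a.
Proof.
move=> N0; have N0r : (N%:R : R) != 0 by rewrite pnatr_eq0; lia.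
have Nv0 : (0 : R) <= N%:R^-1 by rewrite invr_ge0.
rewrite /exp_sum addnS.
under eq_bigr do rewrite bdiff_iterSr rmorphB /= mulrBl.
rewrite sumrB big_nat_recr //= bdiff_profile_out //; last first.
  by right; rewrite natrD mulrDl mulfV.
rewrite mul0r addr0 mulrBl mul1r; congr (_ - _).
rewrite big_nat_recl //= bdiff_profile_out //; last by left; rewrite mul0r sub0r oppr_le0.
rewrite mul0r add0r mulr_sumr; apply: eq_bigr => n _.
rewrite -natr1 mulrDl mul1r addrK mulrDl mul1r cexp2piD.
by rewrite mulrA mulrC.
Qed.

Let exp_sum_iter m N a : (0 < N)%N ->
  exp_sum m (N + m) N a = (1 - cexp2pi a) ^+ m * exp_sum 0 N N a.
Proof.
move=> N0; elim: m => [|m IHm]; first by rewrite mul1r addn0.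
by rewrite exp_sumS // IHm exprS mulrA.
Qed.

Let normc_exp_sum m N a : (0 < N)%N ->
  normc (exp_sum m (N + m) N a) <= (N + m)%:R * ((3 / N%:R) ^+ m * (2 * m)`!%:R).
Proof.
move=> N0; apply: (le_trans (normc_sum _ _ _)).
apply: (@le_trans _ _ (\sum_(0 <= i < N + m) ((3 / N%:R) ^+ m * (2 * m)`!%:R))).
  apply: ler_sum => i _; rewrite Normc.normcM normc_cexp2pi mulr1 normc_real.
  have Nv0 : (0 : R) <= N%:R^-1 by rewrite invr_ge0.
  have := bdiff_profile_pow_le m 0 0 (i%:R / N%:R) Nv0.
  rewrite mulrC [_ * 3]mulrC (@eq_bdiff_iter _ _ _ _ weight_profile) ?add0n // => t.
  exact: profile_pow00.
by rewrite sumr_const_nat subn0 -[leLHS]mulr_natl.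
Qed.

Lemma fact_le_expn n : (n`! <= n ^ n)%N.
Proof.
elim: n => // n IHn; rewrite factS expnS leq_mul2l /=.
by apply: (leq_trans IHn); case: n {IHn} => // n; rewrite leq_exp2r.
Qed.

Lemma expR1_le : expR 1 <= 4 :> R.
Proof.
have := @expR_ge1Dx R (- 2^-1); rewrite (_ : 1 + - 2^-1 = 2^-1) => [h|]; last by field.
have e : expR 1 * (expR (- 2^-1) * expR (- 2^-1)) = 1 :> R.
  by rewrite -!expRD (_ : 1 + (- 2^-1 + - 2^-1) = 0) ?expR0 //; field.
have : expR 1 * (2^-1 * 2^-1) <= 1 :> R.
  rewrite -[leRHS]e ler_wpM2l ?expR_ge0 //; apply: ler_pM => //; rewrite ?invr_ge0 //.
lra.
Qed.

(** After [m] summations by parts, dividing by (2 delta)^m and using (2 m)! <= (2 m)^(2 m), the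
    bound is 2 N (6 m^2 / (delta N))^m. With m the integer part of sqrt(delta N) / 5 the base is at
    most 6/25 < 1/4 <= exp(-1). Rounding [m] down costs a factor exp(1) <= 4, whence 8 N. *)
Lemma normc_exp_sum_le (N : nat) a delta : (0 < N)%N -> 0 <= delta ->
  (forall n : int, delta <= `|a - n%:~R|) ->
  normc (\sum_(0 <= n < N) (weight_profile (n%:R / N%:R))%:C%C * cexp2pi (n%:R * a))
  <= 8 * N%:R * expR (- (Num.sqrt (delta * N%:R) / 5)).
Proof.
move=> N0 d0 ad.
have N0r : (0 : R) < N%:R by rewrite ltr0n.
rewrite -[X in normc X]/(exp_sum 0 N N a).
(* Together with 25 m^2 <= delta N this gives m <= N, so that N + m <= 2 N. *)
have d1 : delta <= 1.
  apply: (le_trans (ad (Num.floor a))); have := floor_itv a; rewrite intrD.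
  by rewrite ler_norml; lra.
set s := Num.sqrt _.
have s0 : 0 <= s by exact: sqrtr_ge0.
have ss : s ^+ 2 = delta * N%:R by rewrite sqr_sqrtr // mulr_ge0 // ltW.
pose m := Num.truncn (s / 5).
have /andP[m1 m2] : m%:R <= s / 5 < m.+1%:R by rewrite truncn_itv // divr_ge0.
have m25 : 25 * m%:R ^+ 2 <= delta * N%:R.
  by rewrite -ss; move: m1; rewrite ler_pdivlMr // => m1; have := ler0n R m; nra.
have mN : (m <= N)%N.
  rewrite -(ler_nat R) leNgt; apply/negP => Nm.
  have : N%:R ^+ 2 <= m%:R ^+ 2 :> R by rewrite ler_pXn2r ?nnegrE // ltW.
  have N1 : (1 : R) <= N%:R by rewrite ler1n.
  nra.
have E : expR (- m%:R) <= 4 * expR (- (s / 5)).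
  apply: (@le_trans _ _ (expR 1 * expR (- (s / 5)))).
    by rewrite -expRD ler_expR; move: m2; rewrite -natr1; lra.
  by rewrite ler_wpM2r ?expR_ge0 // expR1_le.
apply: (@le_trans _ _ (2 * N%:R * expR (- m%:R))); last first.
  rewrite (_ : 8 * _ * _ = 2 * N%:R * (4 * expR (- (s / 5)))); last by ring.
  by rewrite ler_wpM2l // mulr_ge0.
have := normc_exp_sum m a N0; rewrite exp_sum_iter // Normc.normcM normc_exp => H.
have B : (N + m)%:R * ((3 / N%:R) ^+ m * (2 * m)`!%:R) <=
    2 * N%:R * (12 * m%:R ^+ 2 / N%:R) ^+ m :> R.
  apply: ler_pM; rewrite ?mulr_ge0 ?exprn_ge0 ?divr_ge0 //.
    by rewrite -natrM ler_nat; lia.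
  have -> : 12 * m%:R ^+ 2 / N%:R = 3 / N%:R * ((2 * m) ^ 2)%:R :> R.
    by rewrite natrX natrM; field; rewrite gt_eqF.
  rewrite [leRHS]exprMn ler_wpM2l ?exprn_ge0 ?divr_ge0 //.
  by rewrite -natrX ler_nat -expnM fact_le_expn.
have {B}H := le_trans H B.
(* Order 0 is the trivial bound; it includes [delta = 0], where no division is possible. *)
case: (posnP m) => [m0|m0].
  move: H; rewrite m0 !expr0 mul1r oppr0 expR0; lra.
have m0r : (0 : R) < m%:R by rewrite ltr0n.
have dpos : 0 < delta.
  rewrite lt_neqAle d0 andbT; apply/negP => /eqP d00.
  by move: m25; rewrite -d00; nra.
have L : (2 * delta) ^+ m <= normc (1 - cexp2pi a) ^+ m.
  by rewrite lerXn2r ?nnegrE ?normc_ge0 ?mulr_ge0 // normc_1Bcexp2pi_ge.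
have L2 : (2 * delta) ^+ m * normc (exp_sum 0 N N a) <= 2 * N%:R * (12 * m%:R ^+ 2 / N%:R) ^+ m.
  by apply: le_trans H; rewrite ler_wpM2r ?normc_ge0.
have dm0 : 0 < (2 * delta) ^+ m by rewrite exprn_gt0 // mulr_gt0.
have {}L2 : normc (exp_sum 0 N N a) <= 2 * N%:R * (6 * m%:R ^+ 2 / (delta * N%:R)) ^+ m.
  rewrite -(ler_pM2l dm0); apply: (le_trans L2).
  rewrite [leRHS]mulrCA ler_wpM2l ?mulr_ge0 // -exprMn.
  rewrite (_ : 2 * delta * _ = 12 * m%:R ^+ 2 / N%:R) //.
  by field; rewrite !gt_eqF.
apply: (le_trans L2); rewrite ler_wpM2l ?mulr_ge0 //.
rewrite (_ : - m%:R = m%:R * (- 1)); last by rewrite mulrN1.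
rewrite expRM_natl.
rewrite lerXn2r ?nnegrE ?expR_ge0 ?divr_ge0 ?mulr_ge0 ?exprn_ge0 ?(ltW dpos) //.
rewrite expRN ler_pdivrMr ?mulr_gt0 // ler_pdivlMl ?expR_gt0 //.
have := expR1_le; have := expR_ge0 (1 : R); have := sqr_ge0 (m%:R : R).
nra.
Qed.

(** The constant is 8 N divided by the lower bound N exp(-8) / 8 of the sum of the weights. *)
Lemma weighted_exp_average_le (N : nat) a delta : (4 <= N)%N -> 0 <= delta ->
  (forall n : int, delta <= `|a - n%:~R|) ->
  normc ((weight_sum N)^-1%:C%C *
    (\sum_(0 <= n < N) (weight (n%:R / N%:R))%:C%C * cexp2pi (n%:R * a)))
  <= 64 * expR 8 * expR (- (Num.sqrt (delta * N%:R) / 5)).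
Proof.
move=> N4 d0 ad.
have N0 : (0 < N)%N by lia.
have N0r : (0 : R) < N%:R by rewrite ltr0n.
rewrite weighted_average_profile Normc.normcM normc_real.
have P0 : 0 < N%:R * (expR (- 8) / 8) :> R by rewrite mulr_gt0 ?divr_gt0 ?expR_gt0.
have P := weight_profile_sum_ge N4.
have Q0 := lt_le_trans P0 P.
rewrite ger0_norm ?invr_ge0 ?(ltW Q0) // ler_pdivrMl //.
apply: (le_trans (normc_exp_sum_le N0 d0 ad)).
rewrite mulrA ler_wpM2r ?expR_ge0 //.
apply: (@le_trans _ _ (N%:R * (expR (- 8) / 8) * (64 * expR 8))); last first.
  by rewrite ler_wpM2r // mulr_ge0 ?expR_ge0.
have e8 : expR (- 8) * expR 8 = 1 :> R by rewrite -expRD addNr expR0.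
rewrite (_ : _ * (64 * _) = N%:R * 8 * (expR (- 8) * expR 8)); last by field.
by rewrite e8 mulr1 mulrC.
Qed.

End WeightSums.

(** * Resonances and Fourier modes on the torus *)

Section TorusMeasureTheory.
Context {R : realType}.
Local Notation mR := (measurableTypeR R).

(** The additive constant makes the family stable under freezing the first coordinate, as the
    inductions on the dimension require. *)
Definition tuple_phase (d : nat) (k : 'rV[int]_d) (c : R) (t : d.-tuple mR) : R :=
  dotZ k (row_of_tuple t) + c.

Definition behead_freq (d : nat) (k : 'rV[int]_d.+1) : 'rV[int]_d :=
  \row_i k 0 (lift ord0 i).

Lemma measurable_tuple_phase d (k : 'rV[int]_d) c :
  measurable_fun setT (tuple_phase k c).
Proof.
apply: measurable_funD => //.
rewrite /dotZ /row_of_tuple; apply: measurable_sum => i.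
apply: measurable_funM => //.
by under eq_fun do rewrite mxE; exact: measurable_tnth.
Qed.

Lemma tuple_phase_cons d (k : 'rV[int]_d.+1) c (x : mR) t :
  tuple_phase k c (Defs.cons_tuple (x, t)) =
  tuple_phase (behead_freq k) ((k 0 ord0)%:~R * x + c) t.
Proof.
rewrite /tuple_phase /dotZ big_ord_recl /= mxE tnth0 -addrA addrCA; congr (_ + _).
by apply: eq_bigr => i _; rewrite !mxE tnthS.
Qed.

Lemma behead_freq_eq0 d (k : 'rV[int]_d.+1) :
  k != 0 -> behead_freq k = 0 -> k 0 ord0 != 0.
Proof.
move=> k0 k'0; apply: contra_neq k0 => k00; apply/rowP => i; rewrite [RHS]mxE.
case: (unliftP ord0 i) => [j|] -> //.
by move/rowP: k'0 => /(_ j); rewrite !mxE.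
Qed.

Lemma tuple_phase0 d c (t : d.-tuple mR) : tuple_phase 0 c t = c.
Proof. by rewrite /tuple_phase /dotZ big1 ?add0r // => i _; rewrite mxE mul0r. Qed.

Definition resonant (c : R) (eps : R) : set R :=
  [set s | exists n : int, `|s + c - n%:~R| <= eps].

Lemma measurable_resonant c eps : measurable (resonant c eps : set mR).
Proof.
rewrite (_ : resonant c eps = \bigcup_(n : int) `[n%:~R - c - eps, n%:~R - c + eps]%classic).
  by apply: countable_bigcupT_measurable => [|n]; [exact: countableP|exact: measurable_itv].
apply/seteqP; split => s.
  by move=> [n hn]; exists n => //=; rewrite in_itv /=; move: hn; rewrite ler_norml; lra.
by move=> [n _] /=; rewrite in_itv /= => hn; exists n; rewrite ler_norml; lra.
Qed.

Lemma resonant_opp c eps s : resonant c eps s -> resonant (- c) eps (- s).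
Proof.
move=> [n hn]; exists (- n).
by rewrite -normrN (_ : - (- s + - c - (- n)%:~R) = s + c - n%:~R) // mulrNz; ring.
Qed.

Lemma uniform_prob_le_lebesgue (A : set mR) : measurable A ->
  (uniform_prob (@ltr01 R) A <= lebesgue_measure (A `&` `[0%R, 1%R]))%E.
Proof.
move=> mA; rewrite /uniform_prob integral_uniform_pdf.
rewrite (eq_integral (cst 1%E)) ?integral_cst ?mul1e //.
  exact: measurableI.
by move=> x /set_mem[_]; rewrite /= in_itv /= /uniform_pdf => ->; rewrite subr0 invr1.
Qed.

(** If 6 eps < 1, at most k + 2 of the intervals of length 2 eps / k that form the resonant set meet
    [0, 1], and 2 eps (k + 2) / k <= 6 eps. Otherwise the bound exceeds 1. *)
Let uniform_prob_resonant_nat (k : nat) (c eps : R) : (0 < k)%N -> 0 <= eps ->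
  (uniform_prob (@ltr01 R) ((fun x : R => k%:R * x) @^-1` resonant c eps)%R <= (6 * eps)%:E)%E.
Proof.
move=> k0 e0; have mp : measurable ((fun x : R => k%:R * x) @^-1` resonant c eps).
  have mf : measurable_fun [set: mR] (fun x : mR => k%:R * x : mR) by exact: measurable_funM.
  by rewrite -[X in measurable X]setTI; apply: mf => //; exact: measurable_resonant.
have [e1|e1] := leP 1 (6 * eps).
  have := @probability_le1 _ _ _ (uniform_prob (@ltr01 R) : probability mR R) _ mp.
  by move=> /le_trans; apply; rewrite lee_fin.
apply: (le_trans (uniform_prob_le_lebesgue mp)).
have kr : (0 : R) < k%:R by rewrite ltr0n.
pose m0 := Num.floor (c - eps).
pose F (j : nat) : set R := `[((m0 + j%:Z)%:~R - c - eps) / k%:R, ((m0 + j%:Z)%:~R - c + eps) / k%:R]%classic.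
have S : ((fun x : R => k%:R * x) @^-1` resonant c eps) `&` `[0%R, 1%R] `<=`
    \big[setU/set0]_(j < k.+2) F j.
  move=> x [[n hn]]; rewrite /= in_itv /= => /andP[x0 x1].
  move: hn; rewrite ler_norml => /andP[h1 h2].
  have kx0 : 0 <= k%:R * x by rewrite mulr_ge0 // ltW.
  have kx1 : k%:R * x <= k%:R by rewrite -[leRHS]mulr1 ler_wpM2l // ltW.
  have n0 : (m0 <= n)%R.
    by rewrite -(ler_int R); have := floor_le (c - eps); rewrite -/m0; lra.
  have n1 : (n < m0 + k.+2%:Z)%R.
    rewrite -(ltr_int R) intrD /= -!pmulrn -[k.+2]addn2 natrD.
    have := floorD1_gt (c - eps); rewrite -/m0 intrD; lra.
  rewrite -bigcup_mkord; exists `|n - m0|%N => /=; first by lia.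
  rewrite /F (_ : m0 + _ = n); last by lia.
  by rewrite /= in_itv /= ler_pdivrMr // ler_pdivlMr //; apply/andP; split; lra.
have mF j : `I_k.+2 j -> measurable (F j : set mR) by move=> _; exact: measurable_itv.
have mI : measurable (((fun x : R => k%:R * x) @^-1` resonant c eps) `&` `[0%R, 1%R] : set mR).
  by apply: measurableI => //; exact: measurable_itv.
apply: (le_trans (@content_subadditive _ _ _ (@lebesgue_measure R) _ _ _ mF mI S)).
apply: (@le_trans _ _ (\sum_(j < k.+2) (2 * eps / k%:R)%:E)%E).
  apply: lee_sum => j _; rewrite /F /= lebesgue_measure_itv /= lte_fin.
  case: ifPn => _; last by rewrite lee_fin divr_ge0 ?mulr_ge0 // ltW.
  rewrite -EFinB lee_fin -mulrBl ler_pM2r ?invr_gt0 //; lra.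
rewrite sumEFin lee_fin sumr_const card_ord -[leLHS]mulr_natl.
rewrite mulrA ler_pdivrMr // -[k.+2]addn2 natrD.
have : (1 : R) <= k%:R by rewrite ler1n.
nra.
Qed.

Lemma uniform_prob_resonant (k : int) (c eps : R) : k != 0 -> 0 <= eps ->
  (uniform_prob (@ltr01 R) ((fun x : R => k%:~R * x) @^-1` resonant c eps)%R <= (6 * eps)%:E)%E.
Proof.
case: k => [k k0 e0|k _ e0].
  by apply: uniform_prob_resonant_nat => //; rewrite lt0n.
rewrite (_ : _ @^-1` _ = (fun x : R => k.+1%:R * x) @^-1` resonant (- c) eps).
  exact: uniform_prob_resonant_nat.
apply/seteqP; split => x /= /resonant_opp; rewrite NegzE mulrNz -pmulrn mulNr ?opprK //.
Qed.

Lemma measurable_phase_resonant d (k : 'rV[int]_d) c eps :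
  measurable (tuple_phase k c @^-1` resonant 0 eps).
Proof.
rewrite -[X in measurable X]setTI; apply: measurable_tuple_phase => //.
exact: measurable_resonant.
Qed.

(** The bound is uniform in [k] and [c], so it passes to the integral over the first coordinate when
    the remaining frequency is nonzero. When that frequency is 0, each section is empty or
    everything, and the one-dimensional estimate applies to the first coordinate. *)
Lemma cube_measure_resonant d (k : 'rV[int]_d) c eps : k != 0 -> 0 <= eps ->
  (cube_measure d (tuple_phase k c @^-1` resonant 0 eps) <= (6 * eps)%:E)%E.
Proof.
move=> + e0; elim: d k c => [|d IHd] k c k0.
  by case/eqP: k0; apply/rowP => -[].
pose B := Defs.cons_tuple (n := d) @^-1` (tuple_phase k c @^-1` resonant 0 eps).
have mB : measurable B.
  rewrite -[B]setTI; apply: measurable_cons_tuple => //.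
  exact: measurable_phase_resonant.
have xB x : xsection B x =
    tuple_phase (behead_freq k) ((k 0 ord0)%:~R * x + c) @^-1` resonant 0 eps.
  apply/seteqP; split => t; rewrite /xsection /= inE /B /=.
    by rewrite tuple_phase_cons.
  by rewrite -tuple_phase_cons.
(* The image of a product measure unfolds by computation to the integral of the measures of the
   sections. *)
rewrite [leLHS](_ : _ = \int[uniform_prob (@ltr01 R)]_x cube_measure d (xsection B x))%E //.
have [k'0|k'0] := eqVneq (behead_freq k) 0; last first.
  apply: (@le_trans _ _ (\int[uniform_prob (@ltr01 R)]_x (cst (6 * eps)%:E) x)%E).
    apply: ge0_le_integral => //.
    - exact: measurable_fun_xsection.
    - by move=> x _; rewrite xB; exact: IHd.
  by rewrite integral_cst //= probability_setT mule1.
have k00 := behead_freq_eq0 k0 k'0.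
apply: le_trans (uniform_prob_resonant c k00 e0).
set A := _ @^-1` resonant c eps.
have mA : measurable (A : set mR).
  have mf : measurable_fun [set: mR] (fun x : mR => (k 0 ord0)%:~R * x : mR) by exact: measurable_funM.
  by rewrite -[A]setTI; apply: mf => //; exact: measurable_resonant.
rewrite -[X in (_ <= _ X)%E]setIT -integral_indic //.
rewrite le_eqVlt; apply/orP; left; apply/eqP; apply: eq_integral => x _.
rewrite xB k'0 indicE; case: (asboolP (A x)) => Ax.
  rewrite mem_set // (_ : _ @^-1` _ = setT) ?probability_setT //.
  apply/seteqP; split => // t _; rewrite /= tuple_phase0.
  by case: Ax => n hn; exists n; rewrite addr0.
rewrite memNset // (_ : _ @^-1` _ = set0) ?measure0 //.
apply/seteqP; split => // t; rewrite /= tuple_phase0 => -[n].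
by rewrite addr0 => hn; apply: Ax; exists n.
Qed.

Lemma cube_integral_cons d (f : d.+1.-tuple mR -> \bar R) :
  measurable_fun setT f -> (forall t, 0 <= f t)%E ->
  (\int[cube_measure d.+1]_t f t =
   \int[uniform_prob (@ltr01 R)]_x \int[cube_measure d]_t f (Defs.cons_tuple (x, t)))%E.
Proof.
move=> mf f0; rewrite /= ge0_integral_distribution //.
rewrite (@fubini_tonelli1 _ _ _ _ _ _ _ (f \o _)) //.
  by apply: measurableT_comp => //; exact: measurable_cons_tuple.
by move=> x; exact: f0.
Qed.

Lemma integral_cos_affine (k : int) (c : R) : k != 0 ->
  (\int[lebesgue_measure]_(x in `[0%R, 1%R]) (1 + cos (2 * pi * (k%:~R * x + c)))%:E = 1)%E.
Proof.
move=> k0.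
have kr : 2 * pi * k%:~R != 0 :> R by rewrite !mulf_neq0 ?intr_eq0 // gt_eqF // pi_gt0.
pose g (x : R) : R := 1 + cos (2 * pi * (k%:~R * x + c)).
pose G (x : R) : R := x + (2 * pi * k%:~R)^-1 * sin (2 * pi * (k%:~R * x + c)).
have dl (x : R) : is_derive x 1 (fun x : R => 2 * pi * (k%:~R * x + c)) (2 * pi * k%:~R).
  have := is_deriveZ (2 * pi) (is_deriveD (is_deriveZ (k%:~R : R) (is_derive_id x 1)) (is_derive_cst c x 1)).
  by move=> H; apply: (is_derive_eq H); rewrite /GRing.scale /= mulr1 addr0.
have dG (x : R) : is_derive x 1 G (g x).
  have ds := is_derive1_comp (is_derive_sin _) (dl x).
  have := is_deriveD (is_derive_id x 1) (is_deriveZ (2 * pi * k%:~R)^-1 ds).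
  move=> H; apply: (is_derive_eq H); rewrite /GRing.scale /=.
  by rewrite mulrCA mulVf // mulr1.
have dg (x : R) : derivable g x 1.
  have ds := is_derive1_comp (is_derive_cos _) (dl x).
  by have [] := is_deriveD (is_derive_cst (1 : R) x 1) ds.
have cg : continuous g.
  by move=> x; apply/differentiable_continuous/derivable1_diffP.
have cG : continuous G.
  by move=> x; apply/differentiable_continuous/derivable1_diffP; case: (dG x).
rewrite (@continuous_FTC2 _ g G) //.
- rewrite -EFinB /G mulr1 mulr0 !add0r.
  have := cexp2pi_periodic c k; rewrite /cexp2pi => -[_].
  rewrite [c + _]addrC => ->; congr (_%:E); ring.
- exact: continuous_subspaceT.
- split.
  + by move=> x _; case: (dG x).
  + exact/cvg_at_right_filter/cG.
  + exact/cvg_at_left_filter/cG.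
- by move=> x _; rewrite derive1E; case: (dG x).
Qed.

Lemma measurable_cos_phase d (k : 'rV[int]_d) c :
  measurable_fun setT (fun t : d.-tuple mR => cos (2 * pi * tuple_phase k c t)).
Proof.
have mc : measurable_fun [set: mR] (cos : mR -> mR).
  by apply: continuous_measurable_fun; exact: continuous_cos.
have mp := @measurable_tuple_phase d k c.
by apply: (measurableT_comp mc); exact: measurable_funM.
Qed.

(** Adding 1 makes the integrand nonnegative, so that Tonelli's theorem applies directly; the value
    1 expresses that the cosine has mean 0. *)
Lemma cube_integral_1Dcos d (k : 'rV[int]_d) c : k != 0 ->
  (\int[cube_measure d]_t (1 + cos (2 * pi * tuple_phase k c t))%:E = 1)%E.
Proof.
elim: d k c => [|d IHd] k c k0; first by case/eqP: k0; apply/rowP => -[].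
have pos (n : nat) (l : 'rV[int]_n) e t : (0 <= (1 + cos (2 * pi * tuple_phase l e t))%:E)%E.
  by rewrite lee_fin; have := cos_geN1 (2 * pi * tuple_phase l e t); lra.
rewrite cube_integral_cons //; last first.
  by apply/measurable_EFinP; apply: measurable_funD => //; exact: measurable_cos_phase.
under eq_integral do under eq_integral do rewrite tuple_phase_cons.
have [k'0|k'0] := eqVneq (behead_freq k) 0; last first.
  under eq_integral do rewrite IHd //.
  by rewrite integral_cst //= probability_setT mule1.
have k00 := behead_freq_eq0 k0 k'0; rewrite k'0.
under eq_integral.
  move=> x _; under eq_integral do rewrite tuple_phase0.
  rewrite integral_cst //= probability_setT mule1; over.
rewrite integral_uniform.
- by rewrite subr0 invr1 mul1e integral_cos_affine.
- apply/measurable_EFinP; apply: measurable_funD => //.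
  have mc : measurable_fun [set: mR] (cos : mR -> mR).
    by apply: continuous_measurable_fun; exact: continuous_cos.
  apply: (measurableT_comp mc); apply: measurable_funM => //.
  by apply: measurable_funD => //; exact: measurable_funM.
- by move=> x; rewrite lee_fin; have := cos_geN1 (2 * pi * ((k 0 ord0)%:~R * x + c)); lra.
Qed.

Lemma cube_integrable_bounded d (g : d.-tuple mR -> R) (M : R) :
  measurable_fun setT g -> (forall t, `|g t| <= M) ->
  (cube_measure d).-integrable setT (EFin \o g).
Proof.
move=> mg gM; apply: measurable_bounded_integrable => //.
  by apply: le_lt_trans (ltry 1); exact: probability_le1.
exists M; split; first exact: num_real.
by move=> y My t _; exact: (le_trans (gM t) (ltW My)).
Qed.

Lemma cube_Rintegral_cos d (k : 'rV[int]_d) c : k != 0 ->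
  \int[cube_measure d]_t cos (2 * pi * tuple_phase k c t) = 0.
Proof.
move=> k0.
have mc := @measurable_cos_phase d k c.
have {}ic : (cube_measure d).-integrable setT
    (EFin \o (fun t => cos (2 * pi * tuple_phase k c t))).
  by apply: (cube_integrable_bounded mc (M := 1)) => t; rewrite ler_norml cos_geN1 cos_le1.
have i1 : (cube_measure d).-integrable setT (EFin \o (fun _ : d.-tuple mR => 1)).
  by apply: (cube_integrable_bounded (M := 1)) => // t; rewrite normr1.
have c1 : \int[cube_measure d]_t (1 : R) = 1.
  by rewrite /Rintegral integral_cst //= probability_setT mule1.
have := RintegralD measurableT i1 ic.
rewrite c1 {1}/Rintegral cube_integral_1Dcos //=; lra.
Qed.

End TorusMeasureTheory.

(** * Small divisors of almost all rotations *)

Section SmallDivisors.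
Context {R : realType}.
Local Notation mR := (measurableTypeR R).

Definition knorm (d : nat) (k : 'rV[int]_d) : nat := \max_(i < d) `|k 0%R i|%N.

(** The cube of frequencies with [knorm] at most [m], indexed by a finite type. The same type
    indexes the interpolation grid, so frequencies and nodes are equally many. *)
Definition box_freq (d m : nat) (phi : {ffun 'I_d -> 'I_(2 * m).+1}) : 'rV[int]_d :=
  \row_i ((phi i : nat)%:Z - m%:Z).

Lemma box_freq_surj d m (k : 'rV[int]_d) : (knorm k <= m)%N ->
  exists phi : {ffun 'I_d -> 'I_(2 * m).+1}, box_freq phi = k.
Proof.
move=> /bigmax_leqP km.
exists [ffun i => inord (absz (k 0 i + m%:Z))]; apply/rowP => i.
by rewrite !mxE ffunE inordK; have := km i isT; lia.
Qed.

(* The differences of the decreasing sequence p^(-s): summable by telescoping,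
   and of the order of p^(-1-s). *)
Definition eta (s : R) (p : nat) : R := p.+1%:R `^ (- s) - p.+2%:R `^ (- s).

(** Write (p+1)^(-s) as (p+2)^(-s) exp(s (ln(p+2) - ln(p+1))) and use exp x >= 1 + x, both here and
    to get ln(p+2) - ln(p+1) >= 1/(p+2). *)
Lemma eta_ge s p : 0 < s -> s * p.+2%:R `^ (- (1 + s)) <= eta s p.
Proof.
move=> s0; rewrite /eta.
have p1 : (0 : R) < p.+1%:R by rewrite ltr0n.
have p2 : (0 : R) < p.+2%:R by rewrite ltr0n.
have E y x : 0 < x -> x `^ y = expR (y * ln x) :> R by move=> x0; rewrite /powR gt_eqF.
have -> : p.+2%:R `^ (- (1 + s)) = p.+2%:R^-1 * p.+2%:R `^ (- s) :> R.
  by rewrite !E // opprD mulrDl expRD mulN1r expRN lnK.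
have L : p.+2%:R^-1 <= ln p.+2%:R - ln p.+1%:R :> R.
  have := @expR_ge1Dx R (ln p.+1%:R - ln p.+2%:R).
  rewrite expRD expRN !lnK ?posrE // => H.
  have -> : p.+2%:R^-1 = 1 - p.+1%:R / p.+2%:R :> R.
    by rewrite -[p.+2%:R]natr1; move: p1; set a := p.+1%:R => p1; field; apply: lt0r_neq0; lra.
  move: H; set a := ln _; set b := ln _; set c := _ / _ => H; lra.
have := @expR_ge1Dx R (s * (ln p.+2%:R - ln p.+1%:R)).
move=> H.
have -> : p.+1%:R `^ (- s) = p.+2%:R `^ (- s) * expR (s * (ln p.+2%:R - ln p.+1%:R)).
  by rewrite !E // -expRD; congr expR; ring.
have e0 : 0 <= p.+2%:R `^ (- s) by exact: powR_ge0.
have H2 : s * p.+2%:R^-1 <= s * (ln p.+2%:R - ln p.+1%:R) by rewrite ler_pM2l.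
rewrite mulrA [leLHS]mulrC -[X in _ * _ - X]mulr1 -mulrBr.
rewrite ler_wpM2l //; move: H H2; set a := s * p.+2%:R^-1; set b := s * (_ - _); lra.
Qed.

Lemma eta_gt0 s p : 0 < s -> 0 < eta s p.
Proof.
by move=> s0; apply: lt_le_trans (eta_ge p s0); rewrite mulr_gt0 // powR_gt0.
Qed.

Lemma sum_eta_le1 s n : \sum_(0 <= p < n) eta s p <= 1.
Proof.
rewrite /eta (@telescope_sumr_eq _ 0%N n (fun p => - (p.+1%:R `^ (- s)))) //.
  by rewrite powR1 opprK addrC gerBl powR_ge0.
by move=> p _; rewrite opprK addrC.
Qed.

(** At most 3^d 2^(p d) frequencies have [knorm k <= 2 ^ p], and each is resonant on a set of
    measure at most 6 times this number; the union has measure at most 6 3^d [eta s p], which is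
    summable. *)
Definition small_divisor (d : nat) (s : R) (p : nat) : R := eta s p / 2 ^+ (p * d).

Definition log_diophantine (d : nat) (s : R) (rho : 'rV[R]_d) : Prop :=
  exists P0 : nat, forall p, (P0 <= p)%N -> forall k : 'rV[int]_d, k != 0 ->
    (knorm k <= 2 ^ p)%N -> forall n : int,
      small_divisor d s p <= `|dotZ k rho - n%:~R|.

Lemma ae_log_diophantine (d : nat) s : 0 < s ->
  almost_all_rotations (@log_diophantine d s).
Proof.
move=> s0.
pose res p (k : 'rV[int]_d) : set (d.-tuple mR) :=
  tuple_phase k 0 @^-1` resonant 0 (small_divisor d s p).
pose E p : set (d.-tuple mR) := \big[setU/set0]_(phi : {ffun 'I_d -> 'I_(2 * 2 ^ p).+1} | box_freq phi != 0)
  res p (box_freq phi).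
have e0 p : 0 <= small_divisor d s p by rewrite divr_ge0 ?exprn_ge0 // ltW // eta_gt0.
have mE p : measurable (E p).
  by apply: bigsetU_measurable => phi _; exact: measurable_phase_resonant.
have muE p : (cube_measure d (E p) <= (6 * 3 ^+ d * eta s p)%:E)%E.
  pose Q := [pred phi : {ffun 'I_d -> 'I_(2 * 2 ^ p).+1} | box_freq phi != 0].
  apply: (@le_trans _ _ (\sum_(phi | Q phi) (6 * small_divisor d s p)%:E)%E).
    suff [] : measurable (E p) /\
      (cube_measure d (E p) <= \sum_(phi | Q phi) (6 * small_divisor d s p)%:E)%E by [].
    rewrite /E; elim/big_rec2: _ => [|phi a b phi0 [mb ab]].
      by split; [exact: measurable0|rewrite measure0].
    have mr : measurable (res p (box_freq phi)) by exact: measurable_phase_resonant.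
    split; first exact: measurableU.
    apply: (le_trans (measureU2 _ mr mb)); apply: leeD => //.
    exact: cube_measure_resonant.
  rewrite sumEFin lee_fin.
  apply: (@le_trans _ _ (\sum_(phi : {ffun 'I_d -> 'I_(2 * 2 ^ p).+1}) (6 * small_divisor d s p))).
    rewrite big_mkcond; apply: ler_sum => phi _; case: ifP => // _.
    by rewrite mulr_ge0.
  rewrite sumr_const card_ffun !card_ord -[leLHS]mulr_natl /small_divisor.
  have le3 : (2 * 2 ^ p).+1%:R ^+ d <= 3 ^+ d * 2 ^+ (p * d) :> R.
    rewrite exprM -exprMn lerXn2r ?nnegrE ?mulr_ge0 ?exprn_ge0 //.
    by rewrite -natrX -natrM ler_nat; have := expn_gt0 2 p; lia.
  have p0 : 0 < 2 ^+ (p * d) :> R by rewrite exprn_gt0.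
  rewrite natrX 2!mulrA ler_pdivrMr ?exprn_gt0 // -mulrA.
  rewrite (_ : 6 * 3 ^+ d * eta s p * _ = 3 ^+ d * 2 ^+ (p * d) * (6 * eta s p)); last by ring.
  by rewrite ler_wpM2r // mulr_ge0 // ltW // eta_gt0.
have sumE : (\sum_(p <oo) cube_measure d (E p) < +oo)%E.
  apply: (@le_lt_trans _ _ (6 * 3 ^+ d)%:E); last exact: ltry.
  apply: lime_le.
    by apply: is_cvg_nneseries => n _ _; exact: measure_ge0.
  apply: nearW => n.
  apply: (@le_trans _ _ (\sum_(0 <= p < n) (6 * 3 ^+ d * eta s p)%:E)%E).
    by apply: lee_sum => p _; exact: muE.
  rewrite sumEFin lee_fin -mulr_sumr -[leRHS]mulr1.
  by rewrite ler_wpM2l ?sum_eta_le1 // mulr_ge0 ?exprn_ge0.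
have L0 := lim_sup_set_cvg0 mE sumE.
exists (lim_sup_set E); split => //.
  by apply: bigcapT_measurable => n; apply: bigcup_measurable => p _; exact: mE.
move=> t /= nt; apply: contrapT => tE; apply: nt.
have [P0 HP] : exists P0, forall p, (P0 <= p)%N -> ~ E p t.
  apply: contrapT => H; apply: tE => n _.
  have [//|H'] := pselect ((\bigcup_(j in [set j | (n <= j)%N]) E j) t).
  by exfalso; apply: H; exists n => p np Ep; apply: H'; exists p.
exists P0 => p Pp k k0 kp n; rewrite leNgt; apply/negP => lt.
apply: (HP p Pp).
have [phi phik] := box_freq_surj kp.
rewrite /E -(bigcup_pred [pred phi | box_freq phi != 0]).
exists phi => /=; first by rewrite inE phik.
exists n; rewrite addr0 phik /tuple_phase addr0; exact: ltW.
Qed.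

End SmallDivisors.

(** * Trigonometric interpolation on grids *)

Section GridInterpolation.
Context {R : realType} {d : nat}.
Implicit Types (f g H : 'rV[R]_d -> R[i]) (x y : 'rV[R]_d) (k z : 'rV[int]_d).

Lemma dotZDr k x y : dotZ k (x + y) = dotZ k x + dotZ k y.
Proof. by rewrite /dotZ -big_split; apply: eq_bigr => i _; rewrite mxE mulrDr. Qed.

Lemma dotZZr k (a : R) x : dotZ k (a *: x) = a * dotZ k x.
Proof. by rewrite /dotZ mulr_sumr; apply: eq_bigr => i _; rewrite mxE mulrCA. Qed.

Lemma dotZNr k x : dotZ k (- x) = - dotZ k x.
Proof. by rewrite -scaleN1r dotZZr mulN1r. Qed.

Lemma dotZNl k x : dotZ (- k) x = - dotZ k x.
Proof. by rewrite /dotZ -sumrN; apply: eq_bigr => i _; rewrite mxE mulrNz mulNr. Qed.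

Lemma dotZ_delta k i : dotZ k (delta_mx 0 i : 'rV[R]_d) = (k 0 i)%:~R.
Proof.
rewrite /dotZ (bigD1 i) //= mxE !eqxx mulr1 big1 ?addr0 // => j ji.
by rewrite mxE (negbTE ji) andbF mulr0.
Qed.

Lemma dotZ0l x : dotZ 0 x = 0.
Proof. by rewrite /dotZ big1 // => i _; rewrite mxE mul0r. Qed.

Lemma dotZ_int k z : exists n : int, dotZ k (map_mx intr z : 'rV[R]_d) = n%:~R.
Proof.
exists (\sum_i k 0 i * z 0 i); rewrite rmorph_sum; apply: eq_bigr => i _.
by rewrite mxE rmorphM.
Qed.

Lemma abs_dotZ_le k x (a : R) : (forall i, `|x 0 i| <= a) ->
  `|dotZ k x| <= d%:R * (knorm k)%:R * a.
Proof.
move=> xa; apply: (le_trans (ler_norm_sum _ _ _)).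
apply: (@le_trans _ _ (\sum_(i < d) (knorm k)%:R * a)).
  apply: ler_sum => i _; rewrite normrM; apply: ler_pM => //.
  rewrite -intr_norm -natr_absz ler_nat; exact: (leq_bigmax i).
by rewrite sumr_const card_ord -mulrA [leRHS]mulr_natl.
Qed.

Lemma cexp_periodic k : Zd_periodic (fun x => cexp2pi (dotZ k x) : R[i]).
Proof. by move=> x z; rewrite dotZDr; have [n ->] := dotZ_int k z; exact: cexp2pi_periodic. Qed.

Lemma Zd_periodic_bdiff (v : 'rV[R]_d) n f :
  Zd_periodic f -> Zd_periodic (iter n (bdiff v) f).
Proof.
move=> fp; elim: n => // n IHn x z.
by rewrite !bdiff_iterSr addrAC !IHn.
Qed.

Variable m : nat.
Local Notation q := (2 * m).+1.
Local Notation qr := (q%:R : R).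

Definition grid_point (j : {ffun 'I_d -> 'I_q}) : 'rV[R]_d := \row_i ((j i)%:R / qr).

Definition grid_step (i : 'I_d) : 'rV[R]_d := qr^-1 *: delta_mx 0 i.

Let qr_neq0 : qr != 0. Proof. by rewrite pnatr_eq0. Qed.

(** Modulo Z^d, a step permutes the grid cyclically; the integer vector [z] of the proof records the
    wrap-around. *)
Lemma sum_grid_shift H i : Zd_periodic H ->
  \sum_j H (grid_point j + grid_step i) = \sum_j H (grid_point j).
Proof.
move=> Hp; pose sh (j : {ffun 'I_d -> 'I_q}) : {ffun 'I_d -> 'I_q} :=
  [ffun l => if l == i then ordS (j l) else j l].
have shI : injective sh.
  move=> j j' /ffunP E; apply/ffunP => l; have := E l; rewrite !ffunE.
  by case: ifP => // _ /ordS_inj.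
rewrite [RHS](reindex_inj shI); apply: eq_bigr => j _.
pose z : 'rV[int]_d := \row_l (if l == i then ((j l).+1 %/ q)%:Z else 0).
rewrite -(Hp (grid_point (sh j)) z); congr H; apply/rowP => l.
rewrite !mxE !ffunE eqxx /=; case: ifP => li; last by rewrite mulr0 !addr0.
rewrite mulr1 /= -[RHS](mulfK qr_neq0) [in RHS]mulrDl divfK //.
rewrite -pmulrn -natrM -natrD addnC -divn_eq -[in RHS]addn1 natrD.
by rewrite mulrDl mul1r.
Qed.

(** A step in direction [i] multiplies the sum by a root of unity different from 1, yet leaves it
    unchanged. *)
Lemma sum_grid_character z : (exists i, ~~ (q %| `|z 0%R i|)%N) ->
  \sum_j cexp2pi (dotZ z (grid_point j)) = 0 :> R[i].
Proof.
move=> [i qz].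
have := sum_grid_shift i (cexp_periodic z).
under eq_bigr do rewrite dotZDr cexp2piD.
rewrite -mulr_suml dotZZr dotZ_delta => E.
have e1 : cexp2pi (qr^-1 * (z 0 i)%:~R) != 1 :> R[i].
  apply/eqP => e1; have := @normc_1Bcexp2pi_ge R (qr^-1 * (z 0 i)%:~R) qr^-1.
  rewrite e1 subrr Normc.normc0 => H.
  suff : 2 * qr^-1 <= 0 by rewrite pmulr_rle0 // leNgt invr_gt0 ltr0n.
  apply: H => n.
  have -> : qr^-1 * (z 0 i)%:~R - n%:~R = qr^-1 * (z 0 i - n * q%:Z)%:~R.
    by rewrite intrD mulrDr mulrNz intrM -pmulrn; field.
  have q0 : 0 <= qr^-1 by rewrite invr_ge0.
  rewrite normrM (ger0_norm q0) ler_peMr // -intr_norm ler1z.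
  have : z 0 i - n * q%:Z != 0; last by lia.
  by apply: contra qz; rewrite subr_eq0 => /eqP ->; rewrite abszM dvdn_mull.
move: E; set S := (X in X * _ = X -> _) => E.
have /eqP : S * (1 - cexp2pi (qr^-1 * (z 0 i)%:~R)) = 0 by rewrite mulrBr mulr1 E subrr.
by rewrite mulf_eq0 subr_eq0 [1 == _]eq_sym (negbTE e1) orbF => /eqP.
Qed.

Definition grid_coef f k : R[i] :=
  (qr^-1 ^+ d)%:C%C * \sum_j f (grid_point j) * cexp2pi (- dotZ k (grid_point j)).

Definition grid_poly f x : R[i] :=
  \sum_(phi : {ffun 'I_d -> 'I_q}) grid_coef f (box_freq phi) * cexp2pi (dotZ (box_freq phi) x).

(** Frequency and node exchange roles, up to a term independent of [phi]: a sum over frequencies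
    becomes a character sum over the grid. *)
Lemma dotZ_box_grid (phi j j' : {ffun 'I_d -> 'I_q}) :
  dotZ (box_freq phi) (grid_point j) - dotZ (box_freq phi) (grid_point j') =
  dotZ (\row_i ((j i : nat)%:Z - (j' i : nat)%:Z)) (grid_point phi)
  + \sum_i (m%:R * ((j' i)%:R - (j i)%:R) / qr).
Proof.
rewrite /dotZ -sumrB -big_split; apply: eq_bigr => i _; rewrite !mxE /= !intrD !mulrNz -!pmulrn.
by have := qr_neq0; move: qr => Q Q0; field.
Qed.

Lemma grid_polyE f j : grid_poly f (grid_point j) = f (grid_point j).
Proof.
rewrite /grid_poly /grid_coef.
under eq_bigr => phi _.
  rewrite -mulrA mulr_suml.
  under eq_bigr => j' _ do rewrite -mulrA -cexp2piD addrC dotZ_box_grid cexp2piD.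
  over.
rewrite -mulr_sumr exchange_big /=.
under eq_bigr => j' _ do rewrite -mulr_sumr -mulr_suml.
rewrite (bigD1 j) //= [X in _ + X]big1 => [|j' j'j]; last first.
  rewrite sum_grid_character ?mul0r ?mulr0 //.
  have [i ji] : exists i, j' i != j i.
    apply/existsP; apply: contraR j'j; rewrite negb_exists => /forallP E.
    by apply/eqP/ffunP => i; have := E i; rewrite negbK => /eqP.
  exists i; rewrite mxE; apply/negP => dv.
  have := dvdn_leq _ dv; have := ltn_ord (j i); have := ltn_ord (j' i).
  have : (j i : nat) != j' i by apply: contra ji => /eqP E; apply/eqP/val_inj.
  lia.
rewrite addr0 [X in X * cexp2pi _](_ : _ = (qr ^+ d)%:C%C); last first.
  rewrite (eq_bigr (fun=> 1)); last first.
    move=> phi _; rewrite (_ : \row_i _ = 0) ?dotZ0l ?cexp2pi0 //.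
    by apply/rowP => i; rewrite !mxE subrr.
  by rewrite sumr_const card_ffun !card_ord -[LHS]mulr_natr mul1r natrX rmorphXn /= rmorph_nat.
rewrite big1 => [|i _]; last by rewrite subrr mulr0 mul0r.
rewrite cexp2pi0 mulr1 mulrCA -rmorphM /= -exprMn mulVf // expr1n mulr1 //.
Qed.

End GridInterpolation.

(** * Exponential decay of the interpolation coefficients *)

Section GridApproximation.
Context {R : realType} {d : nat}.
Implicit Types (f : 'rV[R]_d -> R[i]) (x y : 'rV[R]_d) (k : 'rV[int]_d).

(* Cauchy-type bounds on differences instead of derivatives. *)
Definition analytic_differences (M : R) f : Prop :=
  forall x i n h, 0 <= h -> n%:R * h * M <= 1 ->
    normc (iter n (bdiff (h *: delta_mx 0 i)) f x) <= M * (M * h) ^+ n * n`!%:R.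

(** Discrete counterpart of the rule that derivation multiplies Fourier coefficients by the
    frequency: the translation passes from [f] to the character. *)
Lemma grid_coef_bdiff m f k i : Zd_periodic f ->
  grid_coef m (bdiff (grid_step m i) f) k =
  (1 - cexp2pi (- dotZ k (grid_step m i))) * grid_coef m f k.
Proof.
move=> fp; rewrite /grid_coef mulrCA; congr (_ * _).
under eq_bigr do rewrite mulrBl.
rewrite sumrB mulrBl mul1r; congr (_ - _).
have Hp : Zd_periodic (fun x => f (x - grid_step m i) * cexp2pi (- dotZ k x)).
  move=> x z; rewrite addrAC fp; congr (_ * _).
  by rewrite -!dotZNl cexp_periodic.
rewrite -(sum_grid_shift m i Hp) mulr_sumr; apply: eq_bigr => j _.
by rewrite addrK dotZDr opprD cexp2piD mulrA mulrC.
Qed.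

Lemma grid_coef_bdiff_iter m f k i n : Zd_periodic f ->
  grid_coef m (iter n (bdiff (grid_step m i)) f) k =
  (1 - cexp2pi (- dotZ k (grid_step m i))) ^+ n * grid_coef m f k.
Proof.
move=> fp; elim: n => [|n IHn]; first by rewrite mul1r.
by rewrite iterS grid_coef_bdiff ?IHn ?exprS ?mulrA //; exact: Zd_periodic_bdiff.
Qed.

Lemma normc_grid_coef_le m f k (M : R) :
  (forall x, normc (f x) <= M) -> normc (grid_coef m f k) <= M.
Proof.
move=> fM; rewrite /grid_coef Normc.normcM normc_real.
have q0 : (0 : R) < (2 * m).+1%:R by rewrite ltr0n.
rewrite ger0_norm ?exprn_ge0 ?invr_ge0 // exprVn ler_pdivrMl ?exprn_gt0 //.
apply: (le_trans (normc_sum _ _ _)).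
apply: (@le_trans _ _ (\sum_(j : {ffun 'I_d -> 'I_(2 * m).+1}) M)).
  by apply: ler_sum => j _; rewrite Normc.normcM normc_cexp2pi mulr1.
by rewrite sumr_const card_ffun !card_ord -natrX [leRHS]mulr_natl.
Qed.

Lemma box_freq_abs m (phi : {ffun 'I_d -> 'I_(2 * m).+1}) i :
  (`|box_freq phi 0%R i| <= m)%N.
Proof. by rewrite mxE; have := ltn_ord (phi i); lia. Qed.

(** Centred residues are the smallest of their class, so the distance from k_i / q to the integers
    is |k_i| / q. *)
Lemma leq_abs_residue (x z : int) m : (absz x <= m)%N -> (absz x <= absz (x + z * (2 * m).+1%:Z)%R)%N.
Proof.
move=> xm; have : z = 0 \/ (1 <= z)%R \/ (z <= - 1)%R by lia.
case=> [->|[z1|z1]]; first by lia.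
  by have : ((2 * m).+1%:Z <= z * (2 * m).+1%:Z)%R; [nia|lia].
by have : (z * (2 * m).+1%:Z <= - (2 * m).+1%:Z)%R; [nia|lia].
Qed.

(** Comparing [n] differences of step 1/q with the factor (2 |k_i| / q)^n that they put on the
    coefficient, the mesh cancels and M (M n / (2 |k_i|))^n remains. For n the integer part of |k_i|
    / (2 M) this is at most M 4^(-n) <= M exp(-n), and the rounding costs the factor 4. The step is
    admissible because 2 M n <= |k_i| <= m < q. *)
Lemma grid_coef_coord_decay m f M (phi : {ffun 'I_d -> 'I_(2 * m).+1}) i : 0 < M ->
  Zd_periodic f -> analytic_differences M f ->
  normc (grid_coef m f (box_freq phi)) <=
    4 * M * expR (- ((2 * M)^-1 * `|box_freq phi 0%R i|%N%:R)).
Proof.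
move=> M0 fp fM; set k := box_freq phi; set a := `|k 0%R i|%N.
set c := normc _.
pose n := Num.truncn ((2 * M)^-1 * a%:R : R).
have t0 : 0 <= (2 * M)^-1 * a%:R by rewrite mulr_ge0 ?invr_ge0 ?mulr_ge0 // ltW.
have /andP[n1 n2] := truncn_itv t0; rewrite -/n in n1 n2.
have E : expR (- n%:R) <= 4 * expR (- ((2 * M)^-1 * a%:R)).
  apply: (@le_trans _ _ (expR 1 * expR (- ((2 * M)^-1 * a%:R)))).
    by rewrite -expRD ler_expR; move: n2; rewrite -natr1; lra.
  by rewrite ler_wpM2r ?expR_ge0 // expR1_le.
apply: (@le_trans _ _ (M * expR (- n%:R))); last first.
  by rewrite [4 * M]mulrC -mulrA ler_wpM2l // ltW.
have q0 : (0 : R) < (2 * m).+1%:R by rewrite ltr0n.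
have am : a%:R <= m%:R :> R by rewrite ler_nat; exact: box_freq_abs.
have mq : 2 * m%:R <= (2 * m).+1%:R :> R by rewrite -natrM ler_nat.
have nMa : n%:R * (2 * M) <= a%:R by move: n1; rewrite ler_pdivlMl ?mulr_gt0 // mulrC.
have cn j : j%:R * (2 * m).+1%:R^-1 * M <= 1 ->
    normc (1 - cexp2pi (- dotZ k (grid_step m i))) ^+ j * c
    <= M * (M * (2 * m).+1%:R^-1) ^+ j * j`!%:R :> R.
  move=> jM; rewrite -normc_exp -Normc.normcM -grid_coef_bdiff_iter //.
  by apply: normc_grid_coef_le => x; apply: fM => //; rewrite invr_ge0.
case: (posnP n) => [n0|n0].
  rewrite n0 oppr0 expR0 mulr1; have := cn 0%N.
  by rewrite !mul0r !expr0 mul1r fact0 !mulr1; apply; exact: ler01.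
have nr0 : (0 : R) < n%:R by rewrite ltr0n.
have a0 : (0 : R) < a%:R by apply: lt_le_trans nMa; rewrite !mulr_gt0.
have L : 2 * (a%:R / (2 * m).+1%:R : R) <= normc (1 - cexp2pi (- dotZ k (grid_step m i))).
  apply: normc_1Bcexp2pi_ge => z; rewrite /grid_step dotZZr dotZ_delta ler_pdivrMr //.
  have -> : - ((2 * m).+1%:R^-1 * (k 0 i)%:~R) - z%:~R =
      - ((k 0 i + z * (2 * m).+1%:Z)%:~R / (2 * m).+1%:R) :> R.
    by rewrite intrD intrM -!pmulrn; move: q0; move: (_.+1%:R : R) => Q q0; field; rewrite gt_eqF.
  rewrite normrN normrM normfV [X in _ / X]gtr0_norm // divfK ?gt_eqF //.
  rewrite -intr_norm /a -natr_absz ler_nat.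
  exact/leq_abs_residue/box_freq_abs.
have L' : (2 * (a%:R / (2 * m).+1%:R)) ^+ n * c <= M * (M * (2 * m).+1%:R^-1) ^+ n * n`!%:R.
  apply: le_trans (cn n _); last first.
    by rewrite mulrAC ler_pdivrMr // mul1r; lra.
  by rewrite ler_wpM2r ?normc_ge0 // lerXn2r ?nnegrE ?normc_ge0.
have A0 : 0 < (2 * (a%:R / (2 * m).+1%:R)) ^+ n :> R by rewrite exprn_gt0 // mulr_gt0 ?divr_gt0.
rewrite -(ler_pM2l A0); apply: (le_trans L').
rewrite (_ : - n%:R = n%:R * (- 1)); last by rewrite mulrN1.
rewrite expRM_natl mulrCA -mulrA ler_wpM2l ?(ltW M0) // -exprMn.
apply: (@le_trans _ _ ((M * (2 * m).+1%:R^-1) ^+ n * n%:R ^+ n)).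
  rewrite ler_wpM2l ?exprn_ge0 ?mulr_ge0 ?invr_ge0 ?(ltW M0) //.
  by rewrite -natrX ler_nat fact_le_expn.
rewrite -exprMn lerXn2r ?nnegrE ?mulr_ge0 ?invr_ge0 ?expR_ge0 ?(ltW M0) //.
have qi0 : 0 < (2 * m).+1%:R^-1 :> R by rewrite invr_gt0.
move: (_^-1) qi0 => qi qi0.
apply: (@le_trans _ _ (2 * (a%:R * qi) * 4^-1)).
  rewrite (_ : M * qi * n%:R = n%:R * (2 * M) * (qi / 2)); last by field.
  rewrite (_ : 2 * (a%:R * qi) * 4^-1 = a%:R * (qi / 2)); last by field.
  by rewrite ler_wpM2r // divr_ge0 // ltW.
rewrite ler_wpM2l ?mulr_ge0 ?(ltW qi0) //.
by rewrite expRN lef_pV2 ?posrE ?expR_gt0 // expR1_le.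
Qed.

Lemma knorm_attained k : (0 < d)%N -> exists i, knorm k = `|k 0%R i|%N.
Proof.
move=> d0; have [|i ki] := @bigop.eq_bigmax _ (fun i : 'I_d => `|k 0%R i|%N); first by rewrite card_ord.
by exists i.
Qed.

Lemma grid_coef_decay m f M (phi : {ffun 'I_d -> 'I_(2 * m).+1}) : (0 < d)%N -> 0 < M ->
  Zd_periodic f -> analytic_differences M f ->
  normc (grid_coef m f (box_freq phi)) <=
    4 * M * expR (- ((2 * M)^-1 * (knorm (box_freq phi))%:R)).
Proof.
move=> d0 M0 fp fM; have [i ->] := knorm_attained (box_freq phi) d0.
exact: grid_coef_coord_decay.
Qed.

Lemma sum_centered_geometric (r : R) m : 0 <= r ->
  (1 - r) * \sum_(x < (2 * m).+1) r ^+ `|(x : nat)%:Z - m%:Z|%N = 1 + r - 2 * (r * r ^+ m).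
Proof.
move=> r0; elim: m => [|m IHm].
  by rewrite big_ord_recl big_ord0 /= !expr0 addr0; ring.
rewrite (_ : (2 * m.+1).+1 = (2 * m).+3); last by lia.
have -> : \sum_(x < (2 * m).+3) r ^+ `|(x : nat)%:Z - m.+1%:Z|%N =
    r ^+ m.+1 + (\sum_(x < (2 * m).+1) r ^+ `|(x : nat)%:Z - m%:Z|%N + r ^+ m.+1).
  rewrite big_ord_recl big_ord_recr; congr (_ + (_ + _)).
  - by congr (_ ^+ _); rewrite /=; lia.
  - by apply: eq_bigr => x _; congr (_ ^+ _); rewrite /= /bump; lia.
  - by congr (_ ^+ _); rewrite /= /bump; lia.
by rewrite !mulrDr IHm !exprS; ring.
Qed.

(** The sum of the |k_i| is at most d |k|, so each term is dominated by a product of powers of r =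
    exp(-lam / (d + 1)), and the sum by a product of geometric sums, uniformly in [m]. Using d + 1
    keeps the quotient meaningful for d = 0. *)
Lemma sum_box_expR (lam : R) : 0 < lam -> exists2 B : R, 0 < B & forall m,
  \sum_(phi : {ffun 'I_d -> 'I_(2 * m).+1}) expR (- (lam * (knorm (box_freq phi))%:R)) <= B.
Proof.
move=> lam0; pose r := expR (- (lam / d.+1%:R)).
have r1 : r < 1 by rewrite -expR0 ltr_expR oppr_lt0 divr_gt0.
have r0 : 0 < r by exact: expR_gt0.
exists ((2 / (1 - r)) ^+ d); first by rewrite exprn_gt0 // divr_gt0 // subr_gt0.
move=> m; apply: (@le_trans _ _
  (\sum_(phi : {ffun 'I_d -> 'I_(2 * m).+1}) \prod_(i < d) r ^+ `|(phi i : nat)%:Z - m%:Z|%N)).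
  apply: ler_sum => phi _; rewrite prodrXr -expRM_natl ler_expR mulrN lerN2.
  rewrite mulrCA ler_wpM2l ?(ltW lam0) // ler_pdivrMr // -natrM ler_nat mulnS.
  rewrite -[leqLHS]add0n leq_add //.
  apply: (@leq_trans (\sum_(i < d) knorm (box_freq phi))).
    apply: leq_sum => i _; apply: leq_trans (leq_bigmax i); by rewrite mxE.
  by rewrite sum_nat_const card_ord mulnC.
rewrite -(bigA_distr_bigA (fun (_ : 'I_d) (x : 'I_(2 * m).+1) => r ^+ `|(x : nat)%:Z - m%:Z|%N)).
rewrite prodr_const card_ord lerXn2r ?nnegrE ?sumr_ge0 ?divr_ge0 //.
- by move=> x _; rewrite exprn_ge0 // ltW.
- by rewrite subr_ge0 ltW.
rewrite ler_pdivlMr ?subr_gt0 // mulrC sum_centered_geometric ?ltW //.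
have := exprn_gt0 m r0; nra.
Qed.

(** The coordinates are changed one at a time along the points [p j], each change being a single
    backward difference; this is why [y] dominates [x]. *)
Lemma differences_lipschitz M f x y (h : R) : 0 < M ->
  analytic_differences M f -> h * M <= 1 ->
  (forall i, 0 <= y 0 i - x 0 i <= h) -> normc (f y - f x) <= d%:R * (M * (M * h)).
Proof.
move=> M0 fM hM xy.
pose p (j : nat) : 'rV[R]_d := \row_i (if (i < j)%N then y 0 i else x 0 i).
have step (j : nat) : (j <= d)%N -> normc (f (p j) - f x) <= j%:R * (M * (M * h)).
  elim: j => [|j IHj] jd.
    rewrite (_ : p 0%N = x) ?subrr ?Normc.normc0 ?mul0r //.
    by apply/rowP => i; rewrite mxE.
  have := IHj (ltnW jd) => IH.
  rewrite -natr1 mulrDl mul1r -(subrK (f (p j)) (f (p j.+1))) -addrA addrC.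
  apply: (le_trans (normc_triangle _ _)); apply: lerD => //.
  pose i := Ordinal jd.
  have /andP[a0 ah] := xy i.
  have := fM (p j.+1) i 1%N (y 0 i - x 0 i) a0.
  rewrite mul1r /= /bdiff expr1 (_ : 1`! = 1)%N // mulr1 => H.
  have -> : p j = p j.+1 - (y 0 i - x 0 i) *: delta_mx 0 i.
    apply/rowP => l; rewrite !mxE eqxx /=.
    case: (ltngtP l j) => lj.
    - rewrite ltnS (ltnW lj) (_ : l == i = false) ?mulr0 ?subr0 //.
      by apply/negbTE/eqP => li; move: lj; rewrite li ltnn.
    - rewrite ltnS leqNgt lj /= (_ : l == i = false) ?mulr0 ?subr0 //.
      by apply/negbTE/eqP => li; move: lj; rewrite li ltnn.
    - have li : l = i by exact: val_inj.
      by rewrite ltnS lj leqnn li eqxx mulr1 subKr.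
  apply: (le_trans (H _)).
    by apply: le_trans hM; rewrite ler_wpM2r // ltW.
  by rewrite ler_wpM2l ?(ltW M0) // ler_wpM2l ?(ltW M0).
have := step d (leqnn d); rewrite (_ : p d = y) //.
by apply/rowP => i; rewrite mxE ltn_ord.
Qed.

End GridApproximation.

(** * Uniform approximation by trigonometric sums *)

Section TrigonometricApproximation.
Context {R : realType} {d : nat}.
Implicit Types (f : 'rV[R]_d -> R[i]) (x y : 'rV[R]_d) (k : 'rV[int]_d).

(** Substitute for a Fourier series with exponentially decaying coefficients: frequencies and
    coefficients may change with [eps], but [lam] and [B] may not. *)
Definition fourier_approximable (lam B : R) f : Prop :=
  forall eps : R, 0 < eps -> exists (K : seq 'rV[int]_d) (c : 'rV[int]_d -> R[i]),
    (forall x, normc (f x - \sum_(k <- K) c k * cexp2pi (dotZ k x)) <= eps) /\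
    \sum_(k <- K) normc (c k) * expR (lam * (knorm k)%:R) <= B.

(** After translation into [0, 1)^d every coordinate is rounded down, which gives the one-sided
    bounds that [differences_lipschitz] takes. *)
Lemma nearest_grid_point m x : exists (z : 'rV[int]_d) (j : {ffun 'I_d -> 'I_(2 * m).+1}),
  forall i, 0 <= (x + map_mx intr z) 0 i - grid_point j 0 i <= (2 * m).+1%:R^-1.
Proof.
have q0 : (0 : R) < (2 * m).+1%:R by rewrite ltr0n.
exists (\row_i - Num.floor (x 0 i)).
exists [ffun i => inord (Num.truncn ((2 * m).+1%:R * (x 0 i - (Num.floor (x 0 i))%:~R)))].
move=> i; rewrite !mxE ffunE mulrNz.
have /andP[y0 y1] := floor_itv (x 0 i); rewrite intrD in y1.
set y := x 0 i - _; have {}y0 : 0 <= y by rewrite subr_ge0.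
have {}y1 : y < 1 by rewrite /y; lra.
have qy0 : 0 <= (2 * m).+1%:R * y by rewrite mulr_ge0 // ltW.
have /andP[t1 t2] := truncn_itv qy0.
rewrite inordK; last first.
  by rewrite -(ltr_nat R); apply: le_lt_trans t1 _; rewrite -[ltRHS]mulr1 ltr_pM2l.
rewrite subr_ge0 ler_pdivrMr // [y * _]mulrC t1 /= lerBlDl -[X in _ + X]mul1r -mulrDl.
by rewrite ler_pdivlMr // mulrC natr1 ltW.
Qed.

Lemma grid_poly_periodic m f : Zd_periodic (grid_poly m f).
Proof. by move=> x z; apply: eq_bigr => phi _; rewrite cexp_periodic. Qed.

Lemma grid_poly_lipschitz m f x y (h : R) : (forall i, `|y 0 i - x 0 i| <= h) ->
  normc (grid_poly m f y - grid_poly m f x) <=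
  2 * pi * d%:R * h * \sum_(phi : {ffun 'I_d -> 'I_(2 * m).+1})
     normc (grid_coef m f (box_freq phi)) * (knorm (box_freq phi))%:R.
Proof.
move=> xy; rewrite /grid_poly -sumrB (le_trans (normc_sum _ _ _)) // mulr_sumr.
apply: ler_sum => phi _; rewrite -mulrBr Normc.normcM.
set c := normc _; set k := box_freq phi.
have c0 : 0 <= c by exact: normc_ge0.
apply: (@le_trans _ _ (c * (2 * pi * (d%:R * (knorm k)%:R * h)))).
  rewrite ler_wpM2l // (le_trans (normc_cexp2pi_lip _ _)) //.
  rewrite ler_wpM2l ?mulr_ge0 ?pi_ge0 // -dotZNr -dotZDr.
  by apply: abs_dotZ_le => i; rewrite !mxE.
by rewrite le_eqVlt; apply/orP; left; apply/eqP; ring.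
Qed.

(* The interpolating trigonometric polynomials on the grids of mesh 1/(2m+1) have
   uniformly exponentially decaying coefficients, hence are equi-Lipschitz; since they
   agree with f on the grid, they converge to f uniformly. *)
Lemma analytic_differences_approximable M f : (0 < d)%N -> 0 < M ->
  Zd_periodic f -> analytic_differences M f ->
  exists lam B : R, [/\ 0 < lam, 0 < B & fourier_approximable lam B f].
Proof.
move=> d0 M0 fp fM.
(* Half of the decay rate of the coefficients is spent on the exponential weight; the other half
   makes the sum converge. *)
pose lam := (2 * M)^-1 / 2.
have lam0 : 0 < lam by rewrite divr_gt0 ?invr_gt0 ?mulr_gt0.
have [B0 B00 HB] := sum_box_expR (d := d) lam0.
exists lam, (4 * M * B0); split => //; first by rewrite !mulr_gt0.
move=> eps eps0.
(* [D / q] bounds the variation of [f] over one cell plus that of the interpolant. The term [M]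
   added in [m] makes steps up to 1/q admissible for the difference bounds. *)
pose D := d%:R * (M * M) + 2 * pi * d%:R * (4 * M * B0 / lam).
have D0 : 0 <= D.
  by rewrite /D addr_ge0 ?mulr_ge0 ?pi_ge0 ?invr_ge0 ?(ltW M0) ?(ltW B00) ?(ltW lam0).
pose m := (Num.truncn (D / eps + M)).+1.
have mD : D / eps + M <= m%:R.
  have /truncn_itv/andP[_ /ltW] // : 0 <= D / eps + M.
  by rewrite addr_ge0 ?divr_ge0 ?(ltW eps0) ?(ltW M0).
pose q : R := (2 * m).+1%:R.
have q0 : 0 < q by rewrite ltr0n.
have mq : m%:R <= q by rewrite ler_nat; lia.
have De : 0 <= D / eps by rewrite divr_ge0 // ltW.
have cd (phi : {ffun 'I_d -> 'I_(2 * m).+1}) :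
    normc (grid_coef m f (box_freq phi)) * expR (lam * (knorm (box_freq phi))%:R)
    <= 4 * M * expR (- (lam * (knorm (box_freq phi))%:R)).
  rewrite -ler_pdivlMr ?expR_gt0 // -expRN -[leRHS]mulrA -expRD.
  apply: (le_trans (grid_coef_decay phi d0 M0 fp fM)).
  rewrite ler_wpM2l ?mulr_ge0 ?(ltW M0) // ler_expR /lam.
  by rewrite le_eqVlt; apply/orP; left; apply/eqP; field; rewrite gt_eqF.
exists [seq box_freq phi | phi <- index_enum {ffun 'I_d -> 'I_(2 * m).+1}], (grid_coef m f); split; last first.
  rewrite big_map; apply: le_trans (ler_sum _ (fun phi _ => cd phi)) _.
  by rewrite -mulr_sumr ler_wpM2l ?HB ?mulr_ge0 ?(ltW M0).
move=> x; rewrite big_map -/(grid_poly m f x).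
have [z [j Hj]] := nearest_grid_point m x.
rewrite -(fp x z) -(grid_poly_periodic m f x z).
set y := x + _ in Hj *; set g := grid_point j in Hj *.
have -> : f y - grid_poly m f y = (f y - f g) + (grid_poly m f g - grid_poly m f y).
  by rewrite /g grid_polyE addrA subrK.
apply: (le_trans (normc_triangle _ _)).
apply: (@le_trans _ _ (d%:R * (M * (M * q^-1)) + 2 * pi * d%:R * q^-1 * (4 * M * B0 / lam))).
  apply: lerD.
    apply: differences_lipschitz => //.
    by rewrite mulrC ler_pdivrMr // mul1r; lra.
  have gy i : `|g 0 i - y 0 i| <= q^-1.
    by have /andP[h0 h1] := Hj i; rewrite distrC ger0_norm.
  apply: (le_trans (grid_poly_lipschitz m f gy)).
  rewrite ler_wpM2l ?mulr_ge0 ?pi_ge0 ?invr_ge0 ?(ltW q0) //.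
  apply: (@le_trans _ _ (\sum_(phi : {ffun 'I_d -> 'I_(2 * m).+1})
      4 * M / lam * expR (- (lam * (knorm (box_freq phi))%:R)))).
    apply: ler_sum => phi _.
    have := cd phi; set c := normc _; set k := knorm _ => ck.
    have c0 : 0 <= c by exact: normc_ge0.
    have kl : lam * k%:R <= expR (lam * k%:R) by have := expR_ge1Dx (lam * k%:R); lra.
    rewrite mulrAC ler_pdivlMr //; apply: le_trans ck.
    by rewrite -mulrA ler_wpM2l // mulrC.
  rewrite -mulr_sumr (_ : 4 * M * B0 / lam = 4 * M / lam * B0); last by ring.
  by rewrite ler_wpM2l ?HB ?mulr_ge0 ?invr_ge0 ?(ltW M0) ?(ltW lam0).
rewrite (_ : _ + _ = D / q); last by rewrite /D; ring.
rewrite ler_pdivrMr // mulrC -ler_pdivrMr //.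
lra.
Qed.

End TrigonometricApproximation.

(** * Differences of analytic functions *)

Section UnconditionalSums.
Context {R : realType}.

Lemma ltc_normc (z : R[i]) (e : R) : (`|z| < e%:C%C) = (normc z < e).
Proof. by case: z => x y; rewrite normc_def ltcR. Qed.

Lemma partial_sumE (I : choiceType) (F : I -> R[i]) (A : {fset I}) :
  partial_sum F A = \sum_(i <- A) F i.
Proof. by rewrite /partial_sum big_seq_fsetE. Qed.

Lemma totally_cvg (I : choiceType) (F : I -> R[i]) (L : R[i]) (e : R) :
  partial_sum F @ totally --> (L : R[i]^o) -> 0 < e ->
  exists A0 : {fset I}, forall A : {fset I}, (A0 `<=` A)%fset ->
    normc (L - \sum_(i <- A) F i) < e.
Proof.
have PF : ProperFilter (@totally I) := totally_filter.
move=> FL e0; have H := (@cvgrPdist_lt R[i] R[i]^o _ _ _ (partial_sum F) L).1 FL.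
have [|A0 _ HA0] := H _ e%:C%C; first by rewrite ltcR.
by exists A0 => A A0A; rewrite -ltc_normc -partial_sumE; exact: HA0.
Qed.

(** Beyond a finite set, adding one index changes a partial sum by less than 2. *)
Lemma totally_cvg_bounded (I : choiceType) (F : I -> R[i]) (L : R[i]) :
  partial_sum F @ totally --> (L : R[i]^o) ->
  exists2 B : R, 0 < B & forall i, normc (F i) <= B.
Proof.
move=> /totally_cvg/(_ ltr01)[A0 HA0].
have S0 : 0 <= \sum_(i <- A0) normc (F i) by apply: sumr_ge0 => i _; exact: normc_ge0.
exists (2 + \sum_(i <- A0) normc (F i)); first by lra.
move=> i; have [iA|iA] := boolP (i \in A0).
  rewrite (big_fsetD1 i) //=; set S := \sum_(_ <- _) _.
  have : 0 <= S by apply: sumr_ge0 => j _; exact: normc_ge0.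
  lra.
have H1 := HA0 A0 (fsubset_refl _); have H2 := HA0 (i |` A0)%fset (fsubsetU1 _ _).
rewrite big_fsetU1 //= in H2.
have -> : F i = (L - \sum_(j <- A0) F j) - (L - (F i + \sum_(j <- A0) F j)) by ring.
apply: (le_trans (normc_triangle _ _)); rewrite normc_opp; lra.
Qed.

Definition widen_index (d n : nat) (phi : {ffun 'I_d -> 'I_n}) : {ffun 'I_d -> nat} :=
  [ffun i => phi i : nat].

(** One box of multi-indices serves finitely many sums at once, because an m-th difference evaluates
    the power series at m + 1 points. *)
Lemma totally_cvg_box d (J : finType) (F : J -> {ffun 'I_d -> nat} -> R[i]) (L : J -> R[i]) (e : R) :
  (forall j, partial_sum (F j) @ totally --> (L j : R[i]^o)) -> 0 < e ->
  exists n, forall j, normc (L j - \sum_(phi : {ffun 'I_d -> 'I_n}) F j (widen_index phi)) < e.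
Proof.
move=> FL e0; have [A0 HA0] := choice (fun j => totally_cvg (FL j) e0).
pose n := (\max_(j : J) \max_(alpha <- A0 j) \max_(i < d) alpha i).+1.
exists n => j; pose box := [fset widen_index phi | phi in {: {ffun 'I_d -> 'I_n}}]%fset.
have := HA0 j box; rewrite /box big_imfset /=; last first.
  move=> phi psi _ _ /ffunP E; apply/ffunP => i; apply/val_inj.
  by have := E i; rewrite !ffunE.
rewrite big_enum /=; apply; apply/fsubsetP => alpha aA.
have an i : (alpha i < n)%N.
  rewrite ltnS (leq_trans _ (leq_bigmax j)) //.
  by apply: (leq_trans _ (leq_bigmax_seq _ aA isT)); exact: (leq_bigmax i).
apply/imfsetP; exists [ffun i => Ordinal (an i)] => //=.
by apply/ffunP => i; rewrite !ffunE.
Qed.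

End UnconditionalSums.

(** * From local power series to global difference bounds *)

Section AnalyticDifferences.
Context {R : realType} {d : nat}.
Implicit Types (x a : 'rV[R]_d) (f : 'rV[R]_d -> R[i]).

Lemma bdiff_iter_real (V : zmodType) (v : V) (g : V -> R) m (x : V) :
  iter m (bdiff v) (fun y => (g y)%:C%C) x = (iter m (bdiff v) g x)%:C%C.
Proof. by elim: m x => // m IHm x; rewrite !bdiff_iterSr !IHm rmorphB. Qed.

Lemma bin_le_expn n m : ('C(n, m) <= 2 ^ n)%N.
Proof.
elim: n m => [|n IHn] [|m]; rewrite ?bin0 ?bin0n ?expn_gt0 //.
by rewrite binS expnS mul2n -addnn leq_add.
Qed.

Lemma abs_coord_le_norm x i : `|x 0 i| <= `|x|.
Proof.
rewrite [leRHS]/Num.norm /= mx_normrE; exact: (le_bigmax _ (fun i : 'I_1 * 'I_d => `|x i.1 i.2|) (0, i)).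
Qed.

Lemma norm_le_coord x (e : R) : 0 <= e -> (forall i, `|x 0 i| <= e) -> `|x| <= e.
Proof.
move=> e0 xe; rewrite -[leLHS]/(mx_norm x).
have [->//|x0] := eqVneq (mx_norm x) 0.
have [[u i] ->] := mx_norm_neq0 x0; rewrite /= ord1; exact: xe.
Qed.

(** The falling factorial is a binomial coefficient, at most 2^(alpha_i), times m!. The factor
    [tau ^+ m] stands on the left so that no exponent alpha_i - m appears. *)
Lemma bdiff_monomial_le (alpha : {ffun 'I_d -> nat}) a x i m (h tau : R) :
  0 <= h -> 0 <= tau -> (forall l, `|(x - a) 0 l| <= tau) -> `|(x - a) 0 i - m%:R * h| <= tau ->
  `|iter m (bdiff (h *: delta_mx 0 i)) (fun y => monomial alpha (y - a)) x| * tau ^+ m <=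
  \prod_l (2 * tau) ^+ alpha l * (h ^+ m * m`!%:R).
Proof.
move=> h0 tau0 xa xm.
pose P y : R := \prod_(l < d | l != i) (y - a) 0 l ^+ alpha l.
pose l y : R := (y - a) 0 i; pose g (t : R) := t ^+ alpha i.
have Pu y : P (y - h *: delta_mx 0 i) = P y.
  by apply: eq_bigr => j ji; rewrite !mxE (negbTE ji) andbF mulr0 subr0.
have lu y : l (y - h *: delta_mx 0 i) = l y - h.
  by rewrite /l !mxE !eqxx mulr1 addrAC.
have -> : iter m (bdiff (h *: delta_mx 0 i)) (fun y => monomial alpha (y - a)) x =
    P x * iter m (bdiff h) g (l x).
  rewrite -(bdiff_iter_comp _ _ _ Pu lu); apply: eq_bdiff_iter => y.
  by rewrite /monomial (bigD1 i) //= mulrC.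
have Pt : `|P x| <= \prod_(l < d | l != i) tau ^+ alpha l.
  rewrite normr_prod; apply: ler_prod => j _; rewrite normr_ge0 normrX lerXn2r ?nnegrE //.
have Q := bdiff_exp_le (alpha i) h0 (xa i) xm.
rewrite normrM (bigD1 i) //= !exprMn.
have tp : \prod_(l < d | l != i) tau ^+ alpha l <= \prod_(l < d | l != i) (2 * tau) ^+ alpha l.
  apply: ler_prod => j _; rewrite exprn_ge0 //= lerXn2r ?nnegrE ?mulr_ge0 //; lra.
set Y := iter _ _ _ _ in Q *.
have Q' : `|Y| * tau ^+ m <= 2 ^+ alpha i * tau ^+ alpha i * (h ^+ m * m`!%:R).
  case: (ltnP (alpha i) m) => am.
    apply: (@le_trans _ _ 0); last by rewrite !mulr_ge0 ?exprn_ge0.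
    by move: Q; rewrite ffact_small // !mul0r normr_le0 => /eqP ->; rewrite normr0 mul0r.
  apply: (@le_trans _ _ ((alpha i ^_ m)%:R * h ^+ m * tau ^+ (alpha i - m) * tau ^+ m)).
    by rewrite ler_wpM2r ?exprn_ge0.
  rewrite -[_ * _ * tau ^+ m]mulrA -exprD subnK // -bin_ffact natrM.
  rewrite (_ : _ * _ * h ^+ m * _ = 'C(alpha i, m)%:R * (tau ^+ alpha i * (h ^+ m * m`!%:R))); last by ring.
  rewrite -mulrA ler_wpM2r ?mulr_ge0 ?exprn_ge0 //.
  by rewrite -natrX ler_nat bin_le_expn.
have PY := ler_pM (normr_ge0 (P x)) (mulr_ge0 (normr_ge0 Y) (exprn_ge0 m tau0)) (le_trans Pt tp) Q'.
rewrite -[leLHS]mulrA; apply: (le_trans PY).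
by rewrite [leLHS]mulrCA [leLHS]mulrA.
Qed.

Lemma sum_box_half n :
  \sum_(phi : {ffun 'I_d -> 'I_n}) \prod_(i < d) (2^-1 : R) ^+ phi i <= 2 ^+ d.
Proof.
rewrite -(bigA_distr_bigA (fun (_ : 'I_d) (x : 'I_n) => (2^-1 : R) ^+ x)).
rewrite prodr_const card_ord lerXn2r ?nnegrE ?sumr_ge0 //.
suff -> : \sum_(x < n) (2^-1 : R) ^+ x = 2 - 2 * 2^-1 ^+ n.
  by rewrite gerBl mulr_ge0 // exprn_ge0 // invr_ge0.
elim: n => [|n IHn]; first by rewrite big_ord0 expr0 mulr1 subrr.
by rewrite big_ord_recr /= IHn exprS; field.
Qed.

Lemma bdiff_iter_perturb (V : zmodType) (v : V) (f g : V -> R[i]) m (x : V) (eps : R) :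
  (forall j, (j <= m)%N -> normc (f (x - v *+ j) - g (x - v *+ j)) <= eps) ->
  normc (iter m (bdiff v) f x - iter m (bdiff v) g x) <= 2 ^+ m * eps.
Proof.
elim: m x => [|m IHm] x fg.
  by have := fg 0%N (leqnn _); rewrite mulr0n subr0 mul1r.
rewrite !bdiff_iterSr.
set F := iter m (bdiff v) f in IHm *; set G := iter m (bdiff v) g in IHm *.
rewrite (_ : _ - _ = (F x - G x) + - (F (x - v) - G (x - v))); last by ring.
apply: (le_trans (normc_triangle _ _)); rewrite normc_opp exprS.
rewrite (_ : 2 * _ * eps = 2 ^+ m * eps + 2 ^+ m * eps); last by ring.
apply: lerD; apply: IHm => j jm; first by apply: fg; exact: leqW.
by have := fg j.+1 jm; rewrite mulrS opprD addrA.
Qed.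

(** Convergence at the corner a + (r/2, ..., r/2) bounds |c_alpha| (r/2)^|alpha|. For tau = r/16 all
    points of the difference lie within 2 tau of [a], and monomial differences bring (4 tau)^|alpha|
    = 2^(-|alpha|) (r/2)^|alpha|, leaving a geometric series with sum at most 2^d. *)
Lemma analytic_differences_near f a : analytic f ->
  exists2 tau : R, 0 < tau & exists2 B : R, 0 < B &
    forall x, `|x - a| <= tau -> forall i m h, 0 <= h -> m%:R * h <= tau ->
      normc (iter m (bdiff (h *: delta_mx 0 i)) f x) * tau ^+ m <= B * (h ^+ m * m`!%:R).
Proof.
move=> /(_ a)[r r0 [c cf]].
pose u : 'rV[R]_d := const_mx (r / 2).
have [B B0 cB] : exists2 B : R, 0 < B & forall alpha, normc (c alpha) * \prod_l (r / 2) ^+ alpha l <= B.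
  have [|B B0 HB] := totally_cvg_bounded (cf (a + u) _).
    rewrite addrC addKr (le_lt_trans (@norm_le_coord _ (r / 2) _ _)) //; last by lra.
    - by lra.
    - by move=> i; rewrite mxE ger0_norm //; lra.
  exists B => // alpha; apply: le_trans (HB alpha).
  rewrite Normc.normcM normc_real addrC addKr /monomial.
  under [X in _ <= _ * `|X|]eq_bigr do rewrite mxE.
  by rewrite ler_wpM2l ?normc_ge0 // ler_norm.
pose tau := r / 16.
have tau0 : 0 < tau by rewrite /tau; lra.
exists tau => //; exists (2 ^+ d * B); first by rewrite mulr_gt0 ?exprn_gt0.
move=> x xa i m h h0 mh.
pose v : 'rV[R]_d := h *: delta_mx 0 i.
pose S n y := \sum_(phi : {ffun 'I_d -> 'I_n}) c (widen_index phi) * (monomial (widen_index phi) (y - a))%:C%C.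
have SB n : normc (iter m (bdiff v) (S n) x) * (2 * tau) ^+ m <= 2 ^+ d * B * (h ^+ m * m`!%:R).
  rewrite bdiff_iter_sum; apply: (le_trans (ler_wpM2r _ (normc_sum _ _ _))).
    by rewrite exprn_ge0 ?mulr_ge0 // ltW.
  rewrite mulr_suml -[leRHS]mulrA.
  apply: le_trans (ler_wpM2r _ (sum_box_half n)); last first.
    by rewrite !mulr_ge0 ?exprn_ge0 ?(ltW B0).
  rewrite mulr_suml; apply: ler_sum => phi _.
  rewrite bdiff_iterZ bdiff_iter_real Normc.normcM normc_real.
  have := @bdiff_monomial_le (widen_index phi) a x i m h (2 * tau) h0.
  have -> : 0 <= 2 * tau by rewrite mulr_ge0 // ltW.
  move=> /(_ isT) /(_ _ _)/le_trans H.
  rewrite -mulrA; apply: (le_trans (ler_wpM2l (normc_ge0 _) (H _ _ _ (lexx _)))).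
  - by move=> l; apply: (le_trans (abs_coord_le_norm _ _)); lra.
  - have := abs_coord_le_norm (x - a) i; rewrite !ler_norml.
    have mh0 : 0 <= m%:R * h by rewrite mulr_ge0.
    by move: mh xa; rewrite -/tau; lra.
  have -> : \prod_l (2 * (2 * tau)) ^+ widen_index phi l =
      \prod_l 2^-1 ^+ phi l * \prod_l (r / 2) ^+ widen_index phi l.
    rewrite -big_split; apply: eq_bigr => l _; rewrite /widen_index !ffunE /= -exprMn; congr (_ ^+ _).
    by rewrite /tau; field.
  have := cB (widen_index phi); set P1 := \prod_l 2^-1 ^+ phi l; set P2 := \prod_l _.
  set cc := normc _; set hm := h ^+ m * _ => cP.
  rewrite (_ : cc * _ = P1 * (cc * P2 * hm)); last by ring.
  have P10 : 0 <= P1 by apply: prodr_ge0 => l _; rewrite exprn_ge0 // invr_ge0.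
  by rewrite ler_wpM2l // ler_wpM2r // mulr_ge0 // exprn_ge0.
have tm0 : 0 < tau ^+ m by rewrite exprn_gt0.
have tm : tau ^+ m <= (2 * tau) ^+ m by rewrite lerXn2r ?nnegrE ?mulr_ge0 ?(ltW tau0) //; lra.
apply/ler_addgt0Pr => e e0.
(* An m-th difference enlarges the truncation error by at most 2^m, so the total loss is [e]. *)
pose eps := e / (2 ^+ m * tau ^+ m).
have eps0 : 0 < eps by rewrite divr_gt0 ?mulr_gt0 ?exprn_gt0.
have pts (j : 'I_m.+1) : partial_sum (fun alpha => c alpha * (monomial alpha (x - v *+ j - a))%:C%C)
        @ totally --> (f (x - v *+ j) : R[i]^o).
  apply: cf; apply: (@le_lt_trans _ _ (2 * tau)); last by rewrite /tau; lra.
  apply: norm_le_coord => [|l]; first by rewrite mulr_ge0 // ltW.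
  have -> : (x - v *+ j - a) 0 l = (x - a) 0 l - j%:R * h * (l == i)%:R.
    by rewrite /v !mxE mulmxnE !mxE eqxx -[(_ * _) *+ _]mulr_natl; ring.
  have jh0 : 0 <= j%:R * h by rewrite mulr_ge0.
  have jh : j%:R * h <= tau.
    by apply: le_trans mh; rewrite ler_wpM2r // ler_nat -ltnS.
  have := abs_coord_le_norm (x - a) l; rewrite !ler_norml.
  by case: (l == i); rewrite ?mulr0 ?mulr1; lra.
have [n Hn] := totally_cvg_box pts eps0.
have D : normc (iter m (bdiff v) f x - iter m (bdiff v) (S n) x) <= 2 ^+ m * eps.
  by apply: bdiff_iter_perturb => j jm; exact: ltW (Hn (Ordinal (jm : (j < m.+1)%N))).
have T : normc (iter m (bdiff v) f x) <= 2 ^+ m * eps + normc (iter m (bdiff v) (S n) x).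
  apply: le_trans (lerD D (lexx _)); apply: le_trans (normc_triangle _ _).
  by rewrite subrK.
apply: (@le_trans _ _ ((2 ^+ m * eps + normc (iter m (bdiff v) (S n) x)) * tau ^+ m)).
  by rewrite ler_wpM2r // ltW.
rewrite mulrDl addrC; apply: lerD.
  by apply: le_trans (SB n); rewrite ler_wpM2l ?normc_ge0.
by rewrite /eps le_eqVlt; apply/orP; left; apply/eqP; field; rewrite !gt_eqF ?exprn_gt0.
Qed.

(** Compactness of the unit cube and periodicity make the local constants uniform: near each point
    any M above both B and 1/tau works, the condition n h M <= 1 forcing n h <= tau. *)
Lemma analytic_periodic_differences f : Zd_periodic f -> analytic f ->
  exists2 M : R, 0 < M & analytic_differences M f.
Proof.
move=> fp fa.
pose P (M : R) x := forall i n h, 0 <= h -> n%:R * h * M <= 1 ->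
    normc (iter n (bdiff (h *: delta_mx 0 i)) f x) <= M * (M * h) ^+ n * n`!%:R.
pose cube := [set x : 'rV[R]_d | forall i, `[0%R, 1%R]%classic (x ord0 i)].
have cubeK : compact cube.
  by apply: (@rV_compact R d (fun=> `[0%R, 1%R]%classic)) => _; exact: segment_compact.
have near_cube : \forall M \near +oo, cube `<=` P M.
  move/compact_near_coveringP : cubeK; apply => a _.
  have [tau tau0 [B B0 HB]] := analytic_differences_near a fa.
  exists ([set x : 'rV[R]_d | `|x - a| <= tau], [set M | Num.max B tau^-1 < M]).
    split => /=.
    - apply/nbhs_ballP; exists tau => //= y; rewrite -ball_normE /= distrC; exact: ltW.
    - by exists (Num.max B tau^-1); split; [exact: num_real|].
  move=> [x M] /= [xa]; rewrite gt_max => /andP[BM tM] i n h h0 nh.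
  have M0 : 0 < M := lt_trans B0 BM.
  have tM1 : 1 <= M * tau by rewrite -ler_pdivrMr // div1r ltW.
  have nht : n%:R * h <= tau.
    have nh0 : 0 <= n%:R * h by rewrite mulr_ge0.
    by rewrite -(ler_pM2r M0) (le_trans nh) // mulrC.
  have := HB x xa i n h h0 nht; rewrite -ler_pdivlMr ?exprn_gt0 // => /le_trans; apply.
  rewrite ler_pdivrMr ?exprn_gt0 // exprMn.
  rewrite (_ : M * _ * _ * _ = (M * tau) ^+ n * M * (h ^+ n * n`!%:R)); last first.
    by rewrite exprMn; ring.
  rewrite ler_wpM2r ?mulr_ge0 ?exprn_ge0 //.
  rewrite -[B]mul1r ler_pM ?(ltW B0) ?(ltW BM) // exprn_ege1 //.
have [M [M0 HM]] : exists M, 0 < M /\ cube `<=` P M.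
  near +oo_R => M; exists M; split; near: M; first exact: nbhs_pinfty_gt.
  exact: near_cube.
exists M => // x i n h h0 nh.
pose z : 'rV[int]_d := \row_l - Num.floor (x 0 l).
rewrite -(@Zd_periodic_bdiff _ _ _ n _ fp x z); apply: HM => // l /=.
rewrite in_itv /= !mxE mulrNz; have := floor_itv (x 0 l); rewrite intrD.
have -> : x ord0 l = x 0 l by []. lra.
Unshelve. all: by end_near. Qed.

End AnalyticDifferences.

(** * Integral over the torus *)

Section TorusIntegral.
Context {R : realType} {d : nat}.
Local Notation mR := (measurableTypeR R).
Implicit Types (f : 'rV[R]_d -> R[i]) (c : 'rV[int]_d -> R[i]) (K : seq 'rV[int]_d).
Local Notation cube := (cube_measure d).
Local Notation I g := (cube.-integrable setT (EFin \o g)).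

Definition trig_sum K c (x : 'rV[R]_d) : R[i] := \sum_(k <- K) c k * cexp2pi (dotZ k x).

(** The shift [s = - 4^-1] yields the sine, so a single family covers real and imaginary parts. *)
Definition cos_mode (k : 'rV[int]_d) (s : R) (t : d.-tuple mR) : R :=
  cos (2 * pi * tuple_phase k s t).

Lemma integrable_cos_mode k s : I (cos_mode k s).
Proof.
apply: (cube_integrable_bounded (measurable_cos_phase k s) (M := 1)) => t.
by rewrite ler_norml cos_geN1 cos_le1.
Qed.

Lemma cube_RintegralZ (a : R) (g : d.-tuple mR -> R) : I g ->
  I (fun t => a * g t) /\ \int[cube]_t (a * g t) = a * \int[cube]_t g t.
Proof.
move=> ig; split; last by rewrite RintegralZl.
by have := integrableZl measurableT a ig; apply: eq_integrable.
Qed.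

Lemma cube_RintegralD (g h : d.-tuple mR -> R) : I g -> I h ->
  I (fun t => g t + h t) /\
  \int[cube]_t (g t + h t) = \int[cube]_t g t + \int[cube]_t h t.
Proof.
move=> ig ih; split; last by rewrite RintegralD.
by have := integrableD measurableT ig ih; apply: eq_integrable.
Qed.

Lemma cube_Rintegral_cst (a : R) : I (fun=> a) /\ \int[cube]_t a = a.
Proof.
split; first by apply: (cube_integrable_bounded (M := `|a|)).
by rewrite /Rintegral integral_cst //= probability_setT mule1.
Qed.

Lemma cube_Rintegral_cos_mode k s : k != 0 -> \int[cube]_t cos_mode k s t = 0.
Proof. exact: cube_Rintegral_cos. Qed.

Lemma cube_Rintegral_mode k (a b : R) :
  let g t := a * cos_mode k 0 t + b * cos_mode k (- 4^-1) t in
  I g /\ \int[cube]_t g t = if k == 0 then a else 0.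
Proof.
move=> g; have [ia ea] := cube_RintegralZ a (integrable_cos_mode k 0).
have [ib eb] := cube_RintegralZ b (integrable_cos_mode k (- 4^-1)).
have [ig eg] := cube_RintegralD ia ib; split => //; rewrite eg ea eb.
have [->|k0] := eqVneq; last by rewrite !cube_Rintegral_cos_mode // !mulr0 addr0.
rewrite /cos_mode; under eq_Rintegral do rewrite tuple_phase0 mulr0 cos0.
under [X in _ + _ * X]eq_Rintegral do rewrite tuple_phase0.
rewrite !(cube_Rintegral_cst _).2 mulr1 (_ : 2 * pi * - 4^-1 = - (pi / 2)); last by field.
by rewrite cosN cos_pihalf mulr0 addr0.
Qed.

Lemma cos_quarter (s : R) : cos (2 * pi * (s + - 4^-1)) = sin (2 * pi * s).
Proof.
rewrite mulrDr (_ : 2 * pi * - 4^-1 = - (pi / 2)); last by field.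
by rewrite cosD sinN cosN sin_pihalf cos_pihalf; ring.
Qed.

Lemma trig_sum_Re K c t : complex.Re (trig_sum K c (row_of_tuple t)) =
  \sum_(k <- K) (complex.Re (c k) * cos_mode k 0 t + (- complex.Im (c k)) * cos_mode k (- 4^-1) t).
Proof.
rewrite /trig_sum raddf_sum; apply: eq_bigr => k _.
rewrite /cos_mode /tuple_phase addr0 cos_quarter; case: (c k) => a b.
by rewrite /cexp2pi /=; ring.
Qed.

Lemma trig_sum_Im K c t : complex.Im (trig_sum K c (row_of_tuple t)) =
  \sum_(k <- K) (complex.Im (c k) * cos_mode k 0 t + complex.Re (c k) * cos_mode k (- 4^-1) t).
Proof.
rewrite /trig_sum raddf_sum; apply: eq_bigr => k _.
rewrite /cos_mode /tuple_phase addr0 cos_quarter; case: (c k) => a b.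
by rewrite /cexp2pi /=; ring.
Qed.

Lemma cube_Rintegral_trig (a b : 'rV[int]_d -> R) K :
  let g t := \sum_(k <- K) (a k * cos_mode k 0 t + b k * cos_mode k (- 4^-1) t) in
  I g /\ \int[cube]_t g t = \sum_(k <- K | k == 0) a k.
Proof.
elim: K => [|k K [iK eK]] /=.
  rewrite big_nil; have [i0 e0] := cube_Rintegral_cst 0; split.
    by apply: eq_integrable i0 => // t _; rewrite /= big_nil.
  by under eq_Rintegral do rewrite big_nil.
have [ik ek] := cube_Rintegral_mode k (a k) (b k).
have [ig eg] := cube_RintegralD ik iK; split.
  by apply: eq_integrable ig => // t _; rewrite /= big_cons.
under eq_Rintegral do rewrite big_cons.
by rewrite eg ek eK big_cons; case: ifP; rewrite ?add0r.
Qed.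

Lemma Rintegral_close (g h : d.-tuple mR -> R) (eps b : R) :
  measurable_fun setT g -> I h -> \int[cube]_t h t = b ->
  (forall t, `|g t - h t| <= eps) -> `|\int[cube]_t g t - b| <= eps.
Proof.
move=> mg ih <- gh.
have mh : measurable_fun setT h by apply/measurable_EFinP; case/integrableP: ih.
have igh : I (fun t => g t - h t).
  by apply: (cube_integrable_bounded (M := eps)) => //; exact: measurable_funB.
have [ig eg] := cube_RintegralD igh ih.
have -> : \int[cube]_t g t = \int[cube]_t (g t - h t + h t).
  by apply: eq_Rintegral => t _; rewrite subrK.
rewrite eg addrK; apply: (le_trans (le_normr_Rintegral measurableT igh)).
rewrite -[leRHS](cube_Rintegral_cst eps).2; apply: le_Rintegral => //.
- by have := integrable_norm igh; apply: eq_integrable.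
- exact: (cube_Rintegral_cst eps).1.
Qed.

(** Measurability on tuples comes from pointwise limits of trigonometric sums; [P] stands for the
    real or the imaginary part. *)
Lemma measurable_approximable f lam B (P : R[i] -> R) :
  (forall z u, `|P z - P u| <= normc (z - u)) ->
  (forall K c, measurable_fun setT (fun t : d.-tuple mR => P (trig_sum K c (row_of_tuple t)))) ->
  fourier_approximable lam B f ->
  measurable_fun setT (fun t : d.-tuple mR => P (f (row_of_tuple t))).
Proof.
move=> Pl Pm fa.
have n0 n : 0 < n.+1%:R^-1 :> R by rewrite invr_gt0.
have [K HK] := choice (fun n => fa _ (n0 n)).
have [c Hc] := choice HK.
apply: (@measurable_fun_cvg _ _ _ setT
  (fun n t => P (trig_sum (K n) (c n) (row_of_tuple t)))) => // t _.
apply/cvgrPdist_le => e e0; near=> n.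
apply: (le_trans (Pl _ _)); apply: (le_trans ((Hc n).1 _)).
by apply: ltW; near: n; exact: (near_infty_natSinv_lt (PosNum e0)).
Unshelve. all: by end_near. Qed.

Lemma torus_integral_close f lam B K c eps : fourier_approximable lam B f ->
  (forall x, normc (f x - trig_sum K c x) <= eps) ->
  normc (torus_integral f - \sum_(k <- K | k == 0) c k) <= 2 * eps.
Proof.
move=> fa fK.
have iRe K' c' : I (fun t => complex.Re (trig_sum K' c' (row_of_tuple t))) /\
    \int[cube]_t complex.Re (trig_sum K' c' (row_of_tuple t)) = complex.Re (\sum_(k <- K' | k == 0) c' k).
  have [i e] := cube_Rintegral_trig (fun k => complex.Re (c' k)) (fun k => - complex.Im (c' k)) K'.
  split; first by apply: eq_integrable i => // t _; rewrite /= trig_sum_Re.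
  by rewrite raddf_sum -e; apply: eq_Rintegral => t _; rewrite trig_sum_Re.
have iIm K' c' : I (fun t => complex.Im (trig_sum K' c' (row_of_tuple t))) /\
    \int[cube]_t complex.Im (trig_sum K' c' (row_of_tuple t)) = complex.Im (\sum_(k <- K' | k == 0) c' k).
  have [i e] := cube_Rintegral_trig (fun k => complex.Im (c' k)) (fun k => complex.Re (c' k)) K'.
  split; first by apply: eq_integrable i => // t _; rewrite /= trig_sum_Im.
  by rewrite raddf_sum -e; apply: eq_Rintegral => t _; rewrite trig_sum_Im.
have lRe (z u : R[i]) : `|complex.Re z - complex.Re u| <= normc (z - u).
  by apply: le_trans (normc_Re _); rewrite raddfB.
have lIm (z u : R[i]) : `|complex.Im z - complex.Im u| <= normc (z - u).
  by apply: le_trans (normc_Im _); rewrite raddfB.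
have mRe := measurable_approximable lRe (fun K' c' => (measurable_EFinP _ _).1 (measurable_int _ (iRe K' c').1)) fa.
have mIm := measurable_approximable lIm (fun K' c' => (measurable_EFinP _ _).1 (measurable_int _ (iIm K' c').1)) fa.
have cRe := Rintegral_close mRe (iRe K c).1 (iRe K c).2 (fun t => le_trans (lRe _ _) (fK _)).
have cIm := Rintegral_close mIm (iIm K c).1 (iIm K c).2 (fun t => le_trans (lIm _ _) (fK _)).
apply: (le_trans (normc_ReIm _)).
rewrite !raddfB mulr_natl mulr2n; exact: lerD.
Qed.

End TorusIntegral.

(** * Error of the weighted Birkhoff averages *)

Section WeightedBirkhoff.
Context {R : realType} {d : nat}.
Implicit Types (f g : 'rV[R]_d -> R[i]) (rho theta : 'rV[R]_d).

Lemma iter_rotation rho theta n : exists z : 'rV[int]_d,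
  iter n (rotation rho) theta = theta + n%:R *: rho + map_mx intr z.
Proof.
elim: n => [|n [z IHn]]; first by exists 0; rewrite scale0r map_mx0 !addr0.
exists (z - \row_i Num.floor ((iter n (rotation rho) theta) 0 i + rho 0 i)).
apply/rowP => i; rewrite iterS [LHS]mxE /fracpart {1}IHn !mxE intrD mulrNz -natr1.
ring.
Qed.

Lemma periodic_iter_rotation f rho theta n : Zd_periodic f ->
  f (iter n (rotation rho) theta) = f (theta + n%:R *: rho).
Proof. by move=> fp; have [z ->] := iter_rotation rho theta n; rewrite fp. Qed.

Lemma weight_ge0 (x : R) : 0 <= weight x.
Proof. by rewrite mulr_ge0 ?weight_profile_ge0 // invr_ge0 ltW // weight_mass_gt0. Qed.

Lemma weight_sum_gt0 N : (4 <= N)%N -> 0 < weight_sum N :> R.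
Proof.
move=> N4; rewrite /weight_sum /weight -mulr_sumr mulr_gt0 ?invr_gt0 ?weight_mass_gt0 //.
apply: lt_le_trans (weight_profile_sum_ge N4).
by rewrite mulr_gt0 ?divr_gt0 ?expR_gt0 // ltr0n; lia.
Qed.

Definition average N (u : nat -> R[i]) : R[i] :=
  (weight_sum N)^-1%:C%C * \sum_(0 <= n < N) (weight (n%:R / N%:R))%:C%C * u n.

Lemma normc_average_le N u (eps : R) : (4 <= N)%N -> (forall n, normc (u n) <= eps) ->
  normc (average N u) <= eps.
Proof.
move=> N4 ue; have W0 := weight_sum_gt0 N4.
rewrite /average Normc.normcM normc_real ger0_norm ?invr_ge0 ?(ltW W0) //.
rewrite ler_pdivrMl // /weight_sum mulr_suml (le_trans (normc_sum _ _ _)) //.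
apply: ler_sum => n _; rewrite Normc.normcM normc_real ger0_norm ?weight_ge0 //.
by rewrite ler_wpM2l ?weight_ge0.
Qed.

Lemma averageB N u v : average N (fun n => u n - v n) = average N u - average N v.
Proof.
rewrite /average -mulrBr -sumrB; congr (_ * _).
by apply: eq_bigr => n _; rewrite mulrBr.
Qed.

Lemma averageZ N (a : R[i]) u : average N (fun n => a * u n) = a * average N u.
Proof.
rewrite /average mulrCA [in RHS]mulr_sumr; congr (_ * _).
by apply: eq_bigr => n _; rewrite mulrCA.
Qed.

Lemma average_sum N (I : Type) (r : seq I) (u : I -> nat -> R[i]) :
  average N (fun n => \sum_(i <- r) u i n) = \sum_(i <- r) average N (u i).
Proof.
rewrite /average -[RHS]mulr_sumr [in RHS]exchange_big /=; congr (_ * _).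
by apply: eq_bigr => n _; rewrite mulr_sumr.
Qed.

Lemma average1 N : (4 <= N)%N -> average N (fun=> 1) = 1.
Proof.
move=> N4; have W0 := weight_sum_gt0 N4; rewrite /average.
under eq_bigr do rewrite mulr1.
by rewrite -rmorph_sum -rmorphM /= mulVf ?rmorph1 // gt_eqF.
Qed.

Lemma trig_sum_periodic (K : seq 'rV[int]_d) (c : 'rV[int]_d -> R[i]) :
  Zd_periodic (trig_sum K c).
Proof. by move=> x z; apply: eq_bigr => k _; rewrite cexp_periodic. Qed.

(** Replacing [f] costs [eps] in the average and [2 * eps] in the integral, one for each of its real
    and imaginary parts. The zero mode cancels against the integral, and [theta] only enters through
    factors of modulus 1. *)
Lemma Error_le_trig f lam B K (c : 'rV[int]_d -> R[i]) eps rho theta N : (4 <= N)%N ->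
  Zd_periodic f -> fourier_approximable lam B f ->
  (forall x, normc (f x - trig_sum K c x) <= eps) ->
  Error f rho theta N <= 3 * eps +
    \sum_(k <- K | k != 0) normc (c k) * normc (average N (fun n => cexp2pi (n%:R * dotZ k rho))).
Proof.
move=> N4 fp fa fK.
rewrite /Error -/(average N (fun n => f (iter n (rotation rho) theta))).
set S := \sum_(_ <- _ | _) _; set A := average _ _; set T := torus_integral f.
pose G := average N (fun n => trig_sum K c (iter n (rotation rho) theta)).
have AG : normc (A - G) <= eps by rewrite /A /G -averageB; exact: normc_average_le.
pose c0 := \sum_(k <- K | k == 0) c k.
have TC : normc (T - c0) <= 2 * eps by exact: torus_integral_close fa fK.
have GC : normc (G - c0) <= S.
  have -> : G = \sum_(k <- K) c k * (cexp2pi (dotZ k theta) *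
      average N (fun n => cexp2pi (n%:R * dotZ k rho))).
    rewrite /G (_ : (fun n => _) = fun n => \sum_(k <- K) c k *
        (cexp2pi (dotZ k theta) * cexp2pi (n%:R * dotZ k rho))).
      by rewrite average_sum; apply: eq_bigr => k _; rewrite !averageZ.
    apply/funext => n; rewrite periodic_iter_rotation; last exact: trig_sum_periodic.
    by apply: eq_bigr => k _; rewrite dotZDr dotZZr cexp2piD.
  rewrite (bigID (fun k => k == 0)) /= (_ : \sum_(k <- K | k == 0) _ = c0).
    rewrite addrC addrK (le_trans (normc_sum _ _ _)) //.
    by apply: ler_sum => k _; rewrite !Normc.normcM normc_cexp2pi mul1r.
  apply: eq_bigr => k /eqP ->.
  rewrite dotZ0l cexp2pi0 mul1r dotZ0l (_ : (fun n => _) = fun=> 1).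
    by rewrite average1 // mulr1.
  by apply/funext => n; rewrite mulr0 cexp2pi0.
have -> : A - T = (A - G) + ((G - c0) - (T - c0)) by ring.
apply: (le_trans (normc_triangle _ _)).
have := normc_triangle (G - c0) (- (T - c0)); rewrite normc_opp; lra.
Qed.

Lemma Error_ge0 f rho theta N : 0 <= Error f rho theta N.
Proof. exact: normc_ge0. Qed.

(** Every nonzero mode has average at most [D * expR (lam * |k|)]: for |k| <= X because sqrt(delta
    N) = kap X, and for |k| > X by the trivial bound, since exp(lam |k|) then outweighs exp(-lam X).
    Summing against the coefficients gives [D * B], and [eps] tends to 0. *)
Lemma Error_le_decay f lam B rho theta N (kap X : R) : (4 <= N)%N -> 0 < lam -> 0 < kap -> 0 <= X ->
  Zd_periodic f -> fourier_approximable lam B f ->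
  (forall k : 'rV[int]_d, k != 0 -> (knorm k)%:R <= X ->
     forall n : int, kap ^+ 2 * X ^+ 2 / N%:R <= `|dotZ k rho - n%:~R|) ->
  Error f rho theta N <= 64 * expR 8 * B * expR (- (Num.min (kap / 5) lam * X)).
Proof.
move=> N4 lam0 kap0 X0 fp fa H.
have N0 : (0 : R) < N%:R by rewrite ltr0n; lia.
set Cw := 64 * expR 8; have Cw0 : 0 <= Cw by rewrite mulr_ge0 ?expR_ge0.
set mu := Num.min _ _.
have mu1 : mu <= kap / 5 by rewrite ge_min lexx.
have mu2 : mu <= lam by rewrite ge_min lexx orbT.
set D := Cw * expR (- (mu * X)).
have D0 : 0 <= D by rewrite mulr_ge0 ?expR_ge0.
have SD (k : 'rV[int]_d) : k != 0 ->
    normc (average N (fun n => cexp2pi (n%:R * dotZ k rho))) <= D * expR (lam * (knorm k)%:R).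
  move=> k0; have [kX|kX] := leP (knorm k)%:R X.
    have d0 : 0 <= kap ^+ 2 * X ^+ 2 / N%:R.
      by apply: divr_ge0 => //; apply: mulr_ge0; exact: sqr_ge0.
    apply: (le_trans (weighted_exp_average_le N4 d0 (H k k0 kX))).
    rewrite divfK ?gt_eqF // -exprMn sqrtr_sqr ger0_norm ?mulr_ge0 ?(ltW kap0) //.
    rewrite /D -/Cw -[leRHS]mulrA ler_wpM2l // -expRD ler_expR.
    have : mu * X <= kap / 5 * X by rewrite ler_wpM2r.
    have : 0 <= lam * (knorm k)%:R by rewrite mulr_ge0 // ltW.
    lra.
  apply: (le_trans (weighted_exp_average_le N4 (lexx 0) (fun n => normr_ge0 _))).
  rewrite mul0r sqrtr0 mul0r oppr0 expR0 /D -/Cw -[leRHS]mulrA ler_wpM2l // -expRD -[leLHS](expR0 R) ler_expR.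
  have : mu * X <= lam * X by rewrite ler_wpM2r.
  have : lam * X <= lam * (knorm k)%:R by rewrite ler_wpM2l // ltW.
  lra.
rewrite mulrAC -/D; apply/ler_addgt0Pr => e e0.
have e3 : 0 < e / 3 by rewrite divr_gt0.
have [K [c [fK cB]]] := fa _ e3.
apply: (le_trans (@Error_le_trig f lam B K c (e / 3) rho theta N N4 fp fa fK)).
rewrite [leRHS]addrC; apply: lerD; first by rewrite mulrC divfK.
apply: le_trans (ler_wpM2l D0 cB); rewrite mulr_sumr big_mkcond.
apply: ler_sum => k _; case: ifP => [k0|_].
  by rewrite mulrCA ler_wpM2l ?normc_ge0 // SD.
by rewrite !mulr_ge0 ?normc_ge0 ?expR_ge0.
Qed.

End WeightedBirkhoff.

(** * Small divisors in the three cases *)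

Section MainTheorem.
Context {R : realType}.

Lemma is_normZ_ge0 d (nrm : 'rV[int]_d -> R) k : is_normZ nrm -> 0 <= nrm k.
Proof.
move=> [_ nD nZ].
have n0 : nrm 0 = 0 by rewrite -(scale0r 0) nZ normr0 mul0r.
have nN : nrm (- k) = nrm k by rewrite -scaleN1r nZ normrN1 mul1r.
by have := nD k (- k); rewrite subrr n0 nN; lra.
Qed.

Lemma is_normZ_gt0 d (nrm : 'rV[int]_d -> R) k : is_normZ nrm -> k != 0 -> 0 < nrm k.
Proof.
move=> nP k0; rewrite lt_neqAle is_normZ_ge0 // andbT eq_sym.
by apply: contra_neq k0; case: nP => n0 _ _; exact: n0.
Qed.

Lemma is_normZ_le_knorm d (nrm : 'rV[int]_d -> R) : is_normZ nrm ->
  exists2 c : R, 0 < c & forall k, nrm k <= c * (knorm k)%:R.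
Proof.
move=> nP; have nge0 k := is_normZ_ge0 k nP; case: nP => _ nD nZ.
have n0 : nrm 0 = 0 by rewrite -(scale0r 0) nZ normr0 mul0r.
exists (1 + \sum_(i < d) nrm (delta_mx 0 i)).
  by rewrite ltr_pwDl // sumr_ge0.
move=> k; apply: (@le_trans _ _ (\sum_(i < d) nrm (k 0 i *: delta_mx 0 i))).
  rewrite [in leLHS](matrix_sum_delta k) big_ord1.
  elim/big_ind2: _ => [|x a y b xa yb|//]; first by rewrite n0.
  exact: le_trans (nD _ _) (lerD _ _).
rewrite mulrDl mul1r mulr_suml -[leLHS]add0r; apply: lerD => //.
apply: ler_sum => i _; rewrite nZ mulrC ler_wpM2l //.
rewrite -natr_absz ler_nat; exact: (leq_bigmax i).
Qed.

Lemma powR_root (x : R) (n : nat) : 0 <= x -> (x `^ (1 / n.+1%:R)) ^+ n.+1 = x.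
Proof.
by move=> x0; rewrite -powR_mulrn ?powR_ge0 // -powRrM div1r mulVf ?pnatr_eq0 // powRr1.
Qed.

Lemma near_ge4 (P : nat -> Prop) : (forall N, (4 <= N)%N -> P N) -> \forall N \near \oo, P N.
Proof. by move=> H; near=> N; apply: H; near: N; exact: nbhs_infty_ge. Unshelve. all: by end_near. Qed.

(** For X = N^(1/(d+2)) the quantities X^2 / N and X^(-d) coincide. Since the given norm is at most
    [c] times [knorm], the Diophantine bound for |k| <= X provides the required divisors with kap^2
    = C / c^d. *)
Lemma analytic_Error_diophantine d (nrm : 'rV[int]_d -> R) f :
  (0 < d)%N -> is_normZ nrm -> Zd_periodic f -> analytic f ->
  forall C : R, 0 < C -> exists2 cII : R, 0 < cII &
    forall rho : 'rV[R]_d, diophantine nrm C rho ->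
      uniform_bigO (Error f rho) (fun N : nat =>
        expR (- (cII * N%:R `^ (1 / (d + 2)%:R)))).
Proof.
move=> d0 nrmP fp fa C C0.
have [M M0 fM] := analytic_periodic_differences fp fa.
have [lam [B [lam0 B0 fB]]] := analytic_differences_approximable d0 M0 fp fM.
have [c c0 nc] := is_normZ_le_knorm nrmP.
pose kap := Num.sqrt (C / c ^+ d).
have kap0 : 0 < kap by rewrite sqrtr_gt0 divr_gt0 ?exprn_gt0.
exists (Num.min (kap / 5) lam); first by rewrite lt_min lam0 divr_gt0.
move=> rho rhoC; exists (64 * expR 8 * B); first by rewrite !mulr_gt0 ?expR_gt0.
apply: near_ge4 => N N4 theta; rewrite ger0_norm ?Error_ge0 //.
rewrite addn2; set X := N%:R `^ _.
have X0 : 0 < X by rewrite powR_gt0 // ltr0n (leq_trans _ N4).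
have XN : X ^+ d.+2 = N%:R by rewrite powR_root.
apply: Error_le_decay => //; first exact: ltW.
move=> k k0 kX n; apply/ltW; apply: le_lt_trans (rhoC k k0 n).
have nk0 := is_normZ_gt0 nrmP k0.
rewrite -XN sqr_sqrtr; last by rewrite ltW // divr_gt0 // exprn_gt0.
have -> : C / c ^+ d * X ^+ 2 / X ^+ d.+2 = C / (c * X) ^+ d.
  by rewrite exprMn -(addn2 d) exprD; field; rewrite ?expf_neq0 ?gt_eqF.
rewrite ler_pM2l // lef_pV2 ?posrE ?exprn_gt0 ?mulr_gt0 // lerXn2r ?nnegrE ?(ltW nk0) ?mulr_ge0 ?(ltW c0) ?(ltW X0) //.
by apply: (le_trans (nc k)); rewrite ler_pM2l.
Qed.

Lemma trig_sum_approximable d (K : seq 'rV[int]_d) (c : 'rV[int]_d -> R[i]) lam :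
  fourier_approximable lam (\sum_(k <- K) normc (c k) * expR (lam * (knorm k)%:R)) (trig_sum K c).
Proof.
move=> eps eps0; exists K, c; split => // x.
by rewrite subrr Normc.normc0 ltW.
Qed.

Lemma almost_all_rotationsS d (P Q : 'rV[R]_d -> Prop) : (forall rho, P rho -> Q rho) ->
  almost_all_rotations P -> almost_all_rotations Q.
Proof. by move=> PQ; rewrite /almost_all_rotations; apply: filterS => t; exact: PQ. Qed.

(** Finitely many frequencies share one divisor [delta] independent of [N], and the polynomial is
    its own approximation with [eps = 0]. The scale [p] is beyond the threshold [P0], and 2^p
    exceeds all frequencies. *)
Lemma trig_Error_ae d (f : 'rV[R]_d -> R[i]) : trig_polynomial f ->
  almost_all_rotations (fun rho => exists2 cIII : R, 0 < cIII &
    uniform_bigO (Error f rho) (fun N : nat => expR (- (cIII * Num.sqrt N%:R)))).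
Proof.
move=> [K [c fE]].
have {fE} -> : f = trig_sum K c by apply/funext.
apply: almost_all_rotationsS (ae_log_diophantine d (@ltr01 R)) => rho -[P0 HP].
pose p := (P0 + \max_(k <- K) knorm k)%N.
pose delta := small_divisor d (1 : R) p.
have delta0 : 0 < delta by rewrite divr_gt0 ?exprn_gt0 // eta_gt0.
exists (Num.sqrt delta / 5); first by rewrite divr_gt0 // sqrtr_gt0.
exists (1 + 64 * expR 8 * \sum_(k <- K) normc (c k)).
  by rewrite ltr_pwDl // !mulr_ge0 ?expR_ge0 // sumr_ge0 // => k _; exact: normc_ge0.
apply: near_ge4 => N N4 theta; rewrite ger0_norm ?Error_ge0 //.
have H0 x : normc (trig_sum K c x - trig_sum K c x) <= 0 by rewrite subrr Normc.normc0.
apply: (le_trans (Error_le_trig rho theta N4 (trig_sum_periodic K c)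
   (@trig_sum_approximable d K c 1) H0)).
rewrite mulr0 add0r mulrDl mul1r -[leLHS]add0r; apply: lerD; first exact: expR_ge0.
rewrite -mulrA mulr_suml mulr_sumr big_mkcond big_seq [leRHS]big_seq; apply: ler_sum => k kK.
case: ifP => [k0|_]; last by rewrite !mulr_ge0 ?normc_ge0 ?expR_ge0.
rewrite mulrCA ler_wpM2l ?normc_ge0 //.
have kp : (knorm k <= 2 ^ p)%N.
  apply: (leq_trans _ (ltnW (ltn_expl p (isT : 1 < 2)%N))).
  by apply: (leq_trans _ (leq_addl _ _)); exact: leq_bigmax_seq.
apply: (le_trans (weighted_exp_average_le N4 (ltW delta0) (HP p (leq_addr _ _) k k0 kp))).
by rewrite sqrtrM ?(ltW delta0) // [Num.sqrt delta * _ / 5]mulrAC.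
Qed.

Lemma ln_le_trunc_log (x : R) : 1 <= x -> (trunc_log 2 (Num.truncn x))%:R <= 2 * ln x.
Proof.
move=> x1; set L := trunc_log _ _.
have x0 : 0 < x by lra.
have Lx : 2 ^+ L <= x.
  rewrite -natrX (le_trans _ (_ : (Num.truncn x)%:R <= x)) ?truncn_le ?(ltW x0) // ler_nat.
  by rewrite trunc_logP // truncn_gt0.
have l2 : 1 <= 2 * ln 2 :> R.
  have -> : 2 * ln 2 = ln 4 :> R by rewrite mulr_natl -lnXn // -natrX.
  by rewrite -[leLHS](expRK 1) ler_ln ?posrE ?expR_gt0 // expR1_le.
have : ln (2 ^+ L) <= ln x by rewrite ler_ln ?posrE ?exprn_gt0.
rewrite lnXn // -[leLHS]mulr_natl => Lln.
apply: (@le_trans _ _ (L%:R * (2 * ln 2))); first by rewrite ler_peMr.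
by rewrite mulrCA ler_pM2l.
Qed.

Lemma truncn_log_bounds (x : R) : 1 <= x ->
  x <= 2 ^+ (trunc_log 2 (Num.truncn x)).+1 <= 2 * x.
Proof.
move=> x1; have x0 : 0 <= x by lra.
have /andP[t1 t2] := truncn_itv x0.
apply/andP; split.
  by apply: (le_trans (ltW t2)); rewrite -natrX ler_nat trunc_log_ltn.
rewrite exprS ler_pM2l // (le_trans _ t1) // -natrX ler_nat.
by rewrite trunc_logP // truncn_gt0.
Qed.

(* X is the truncation level N^(1/(d+2)) (ln N)^(-(1+s)/(d+2)) balancing the decay of the
   Fourier coefficients against the small divisors of size (ln X)^(-(1+s)) X^(-d). *)
Lemma log_diophantine_divisor d s (rho : 'rV[R]_d) : 0 < s -> log_diophantine s rho ->
  exists2 kap : R, 0 < kap & forall (N : nat) (X : R), (4 <= N)%N -> 0 < X ->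
    X ^+ d.+2 = N%:R * ln N%:R `^ (- (1 + s)) ->
    forall k : 'rV[int]_d, k != 0 -> (knorm k)%:R <= X ->
    forall n : int, kap ^+ 2 * X ^+ 2 / N%:R <= `|dotZ k rho - n%:~R|.
Proof.
move=> s0 [P0 HP].
(* Chosen so that p + 2 = P0 + L + 3 <= A ln N, by L <= 2 ln N and 1 <= ln N. Together with 2^p <=
   2^(P0 + 1) X this yields [kap2]. Shifting the scale by [P0] avoids requiring [N] to be large. *)
pose A : R := P0%:R + 5.
pose kap2 := s * A `^ (- (1 + s)) / (2 ^+ P0.+1) ^+ d.
have A0 : 0 < A by rewrite ltr_wpDl.
have kap0 : 0 < kap2 by rewrite divr_gt0 ?exprn_gt0 ?mulr_gt0 ?powR_gt0.
exists (Num.sqrt kap2); first by rewrite sqrtr_gt0.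
move=> N X N4 X0 XN k k0 kX n; rewrite sqr_sqrtr ?(ltW kap0) //.
have k1 : (1 : R) <= (knorm k)%:R.
  rewrite ler1n lt0n; apply: contra k0 => /eqP kn0; apply/eqP/rowP => i; rewrite mxE.
  have : (`|k 0%R i| <= knorm k)%N by exact: (leq_bigmax i).
  by rewrite kn0 leqn0 absz_eq0 => /eqP.
have X1 := le_trans k1 kX.
have N0 : (0 : R) < N%:R by rewrite ltr0n (leq_trans _ N4).
have lnN : 1 <= ln N%:R :> R.
  rewrite -[leLHS](expRK 1) ler_ln ?posrE ?expR_gt0 //.
  by apply: (le_trans (@expR1_le R)); rewrite ler_nat.
have XleN : X <= N%:R.
  apply: (@le_trans _ _ (X ^+ d.+2)); first by rewrite exprS ler_peMr ?exprn_ege1 // ltW.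
  rewrite XN ler_piMr // -[leRHS](powRr0 (ln N%:R)) ler_powR //; lra.
pose L := trunc_log 2 (Num.truncn X).
have /andP[XL LX] := truncn_log_bounds X1; rewrite -/L in XL LX.
have LN : L%:R <= 2 * ln N%:R :> R.
  by apply: (le_trans (ln_le_trunc_log X1)); rewrite ler_pM2l // ler_ln ?posrE.
pose p := (P0 + L.+1)%N.
have kp : (knorm k <= 2 ^ p)%N.
  rewrite -(ler_nat R) natrX (le_trans kX) // (le_trans XL) //.
  by rewrite /p ler_weXn2l ?ler1n // leq_addl.
apply: le_trans (HP p (leq_addr _ _) k k0 kp n).
rewrite /small_divisor ler_pdivlMr ?exprn_gt0 //.
apply: le_trans (eta_ge p s0).
have pA : p.+2%:R <= A * ln N%:R.
  have -> : p.+2%:R = P0%:R + L%:R + 3 :> R by rewrite -!natrD /p addnS addn3.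
  have : P0%:R <= P0%:R * ln N%:R :> R by rewrite ler_peMr.
  by rewrite /A mulrDl; lra.
have Aln0 : 0 < A * ln N%:R by rewrite mulr_gt0 //; lra.
have powp : (A * ln N%:R) `^ (- (1 + s)) <= p.+2%:R `^ (- (1 + s)).
  rewrite !powRN lef_pV2 ?posrE ?powR_gt0 //.
  by rewrite ge0_ler_powR ?nnegrE ?(ltW Aln0) //; lra.
apply: le_trans (ler_wpM2l (ltW s0) powp).
rewrite powRM ?(ltW A0) //; last by lra.
have NE : ln N%:R `^ (- (1 + s)) / X ^+ d = X ^+ 2 / N%:R.
  have Xn0 : X != 0 by rewrite gt_eqF.
  have Nn0 : N%:R != 0 :> R by rewrite gt_eqF.
  by apply/eqP; rewrite eqr_div ?expf_neq0 // mulrC -XN -exprD.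
rewrite -mulrA -NE /kap2 exprM.
have pX : (2 ^+ p) ^+ d <= (2 ^+ P0.+1) ^+ d * X ^+ d.
  rewrite -exprMn lerXn2r ?nnegrE ?mulr_ge0 ?exprn_ge0 ?(ltW X0) //.
  by rewrite /p exprD [2 ^+ P0.+1]exprSr -mulrA ler_wpM2l ?exprn_ge0.
have ll0 : 0 <= ln N%:R `^ (- (1 + s)) by exact: powR_ge0.
have AA0 : 0 <= A `^ (- (1 + s)) by exact: powR_ge0.
have Xd : 0 < X ^+ d by rewrite exprn_gt0.
have Qd : 0 < (2 ^+ P0.+1) ^+ d :> R by rewrite !exprn_gt0.
move: pX Xd Qd ll0 AA0; set a := A `^ _; set l := ln _ `^ _; set Q := (2 ^+ P0.+1) ^+ d.
set x := X ^+ d; set y := (2 ^+ p) ^+ d => pX x0 Q0 l0 a0.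
rewrite (_ : s * a / Q * (l / x) * y = s * (a * l) * (y / (Q * x))); last first.
  by field; rewrite !gt_eqF.
by rewrite ler_piMr ?mulr_ge0 ?(ltW s0) // ler_pdivrMr ?mulr_gt0 // mul1r.
Qed.

Lemma analytic_Error_ae d f : (0 < d)%N -> Zd_periodic f -> analytic f ->
  almost_all_rotations (fun rho : 'rV[R]_d => forall zeta : R, 1 < zeta ->
    uniform_bigO (Error f rho) (fun N : nat =>
      expR (- (1 * N%:R `^ (1 / (d + 2)%:R) * ln N%:R `^ (- (zeta / (d + 2)%:R)))))).
Proof.
move=> d0 fp fa.
have [M M0 fM] := analytic_periodic_differences fp fa.
have [lam [B [lam0 B0 fB]]] := analytic_differences_approximable d0 M0 fp fM.
(* Only countably many null sets may be discarded, so [s] runs over the numbers 1/(j+1); each zeta >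
   1 admits such an [s] with 1 + s < zeta. *)
have : almost_all_rotations (fun rho : 'rV[R]_d => forall j : nat, log_diophantine (j.+1%:R^-1 : R) rho).
  rewrite /almost_all_rotations.
  have := @ae_foralln _ _ _ (cube_measure d) (fun j t => log_diophantine (j.+1%:R^-1 : R) (row_of_tuple t)).
  by apply => j; apply: ae_log_diophantine.
apply: almost_all_rotationsS => rho rhoP zeta zeta1.
have [j jz] : exists j : nat, j.+1%:R^-1 < zeta - 1.
  have z0 : 0 < zeta - 1 by lra.
  have [j _ Hj] := near_infty_natSinv_lt (PosNum z0).
  by exists j; apply: Hj => /=.
set s : R := j.+1%:R^-1 in jz.
have s0 : 0 < s by rewrite invr_gt0.
have [kap kap0 H] := log_diophantine_divisor s0 (rhoP j).
pose mu := Num.min (kap / 5) lam.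
have mu0 : 0 < mu by rewrite lt_min lam0 divr_gt0.
exists (64 * expR 8 * B); first by rewrite !mulr_gt0 ?expR_gt0.
pose e := (zeta - (1 + s)) / d.+2%:R.
have e0 : 0 < e by rewrite divr_gt0 //; lra.
near=> N => theta.
have N4 : (4 <= N)%N by near: N; exact: nbhs_infty_ge.
(* From here on (ln N)^e >= 1/mu, which replaces the rate [mu] by 1. *)
have NT : expR (mu `^ (- e^-1)) <= N%:R by near: N; exact: nbhs_infty_ger.
have N0 : (0 : R) < N%:R by rewrite ltr0n (leq_trans _ N4).
have lnT : mu `^ (- e^-1) <= ln N%:R by rewrite -[leLHS]expRK ler_ln ?posrE ?expR_gt0.
have T0 : 0 < mu `^ (- e^-1) by rewrite powR_gt0.
have lnN0 := lt_le_trans T0 lnT.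
rewrite ger0_norm ?Error_ge0 // mul1r addn2.
set r := N%:R `^ _.
pose X := r * ln N%:R `^ (- ((1 + s) / d.+2%:R)).
have r0 : 0 < r by rewrite powR_gt0.
have X0 : 0 < X by rewrite mulr_gt0 ?powR_gt0.
have XN : X ^+ d.+2 = N%:R * ln N%:R `^ (- (1 + s)).
  by rewrite exprMn powR_root ?ler0n // -[in LHS]powR_mulrn ?powR_ge0 // -powRrM mulNr divfK.
apply: (le_trans (Error_le_decay theta N4 lam0 kap0 (ltW X0) fp fB (H N X N4 X0 XN))).
rewrite ler_wpM2l ?mulr_ge0 ?expR_ge0 ?(ltW B0) // ler_expR lerN2 -/mu.
have -> : - (zeta / d.+2%:R) = - ((1 + s) / d.+2%:R) + - e by rewrite /e; field; rewrite ?pnatr_eq0.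
rewrite powRD; last by rewrite (gt_eqF lnN0) implybT.
rewrite mulrA -/X mulrC ler_wpM2r ?(ltW X0) //.
rewrite powRN -[leRHS]invrK lef_pV2 ?posrE ?powR_gt0 ?invr_gt0 //.
have -> : mu^-1 = (mu `^ (- e^-1)) `^ e.
  by rewrite -powRrM mulNr mulVf ?gt_eqF // powRN powRr1 // ltW.
by rewrite ge0_ler_powR ?nnegrE ?(ltW e0) ?(ltW T0) ?(ltW lnN0).
Unshelve. all: by end_near. Qed.

End MainTheorem.

Theorem theorem6p1 (R : realType) (d : nat) (d_gt0 : (0 < d)%N)
    (nrm : 'rV[int]_d -> R) (nrmP : is_normZ nrm) :
  [/\ (* (I) *)
      exists2 cI : R, 0 < cI &
        forall f : 'rV[R]_d -> R[i], Zd_periodic f -> analytic f ->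
          almost_all_rotations (fun rho => forall zeta : R, 1 < zeta ->
            uniform_bigO (Error f rho) (fun N : nat =>
              expR (- (cI * N%:R `^ (1 / (d + 2)%:R) *
                       ln N%:R `^ (- (zeta / (d + 2)%:R)))))),
      (* (II) *)
      forall f : 'rV[R]_d -> R[i], Zd_periodic f -> analytic f ->
        forall C : R, 0 < C -> exists2 cII : R, 0 < cII &
          forall rho : 'rV[R]_d, diophantine nrm C rho ->
            uniform_bigO (Error f rho) (fun N : nat =>
              expR (- (cII * N%:R `^ (1 / (d + 2)%:R))))
    & (* (III) *)
      forall f : 'rV[R]_d -> R[i], trig_polynomial f ->
        almost_all_rotations (fun rho => exists2 cIII : R, 0 < cIII &
          uniform_bigO (Error f rho) (fun N : nat =>
            expR (- (cIII * Num.sqrt N%:R))))].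
Proof.
split.
- by exists 1 => // f fp fa; exact: analytic_Error_ae.
- by move=> f fp fa; exact: analytic_Error_diophantine.
- by move=> f; exact: trig_Error_ae.
Qed.
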